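(* Let $p\geq 80$ be a prime and let $m$ be an integer in $[2,p-2]$. Let $c=c(p)\in(0,1)$ be the solution of the equation $$\Big(7+\sqrt{8\,c\,p\sin(\pi/p)/\sin(\pi c/3)+9}\Big)\,c=4+\frac{12}{p}.$$ Then $d_m(\mathbb{Z}/p\mathbb{Z})<c$. In particular, for every integer $m\geq 3$, $d_m\leq \frac{1}{3.1955}$.
   Context: For a positive integer $m$, a subset $A$ of an abelian group is $m$-sum-free if there is no triple $(x,y,z)\in A^3$ with $x+y=mz$. For a prime $p$, $d_m(\mathbb{Z}/p\mathbb{Z})=\max\{|A|/p : A\subseteq \mathbb{Z}/p\mathbb{Z}\ \text{is } m\text{-sum-free}\}$. For $m\ge 3$ it is known (from prior work) that $d_m(\mathbb{Z}/p\mathbb{Z})$ converges as $p\to\infty$ through primes; $d_m$ denotes this limit. *)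

(* Defs.v *)
From Stdlib Require Import Reals.
From mathcomp Require Import all_boot.

Definition m_sum_free (p m : nat) (A : {set 'I_p}) : bool :=
  [forall x in A, forall y in A, forall z in A,
     ((x + y) %% p)%N != ((m * z) %% p)%N].

Definition dmZp (p m : nat) : R :=
  Rdiv (INR (\max_(A : {set 'I_p} | m_sum_free p m A) #|A|)) (INR p).

Definition dm_limit (m : nat) (l : R) : Prop :=
  forall eps : R, Rgt eps 0 ->
    exists N : nat, forall p : nat, prime p -> (N <= p)%N ->
      Rlt (Rabs (Rminus (dmZp p m) l)) eps.

(* Main.v *)
Require Import Defs.
From HB Require Import structures.
From Stdlib Require Import Reals Lra.
From mathcomp Require Import all_boot fingroup quotient zmodp cyclic zify.
Set Implicit Arguments. Unset Strict Implicit. Unset Printing Implicit Defensive.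

(** Let [A] be [m]-sum-free with [k] elements.  Since [A + A] misses the dilate
    [m A], it has at most [p - k] elements, and [sum_r A^(r)^2 conj (A^(m r)) = 0]
    forces a nontrivial Fourier coefficient of size at least [k^2 / (p - k)].  By
    a rearrangement argument of Lev, some dilate of [A] then has so many
    elements in a half-circle, say [n] of them, that [3n - 4 >= p - k]; the
    equation defining [c] is the condition under which this holds when
    [k >= c p].  So Freiman's [3k-4] theorem applies to these [n] elements: they
    lie in a short progression and their sumset contains a progression of length
    [2n - 1], which [m A] avoids.  Now [m A - A] misses [A] and does not wrap around
    modulo [p], so it contains an interval of length [k + n - 1], and the whole of
    [A] lies in a half-circle.  Repeating the argument with [n = k], both [A] and
    [m A] lie in intervals of length [p - 2k + 1].  Hence every small multiple of [m]
    is at distance at most [p - 2k] from [0] modulo [p], which is impossible.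

    The [3k-4] theorem for a set [X] of integers with minimum [0] and maximum [u]
    is obtained from Mann's theorem in [Z/u]: if [X] were sparse in [[0, u]], then
    some coset structure would make [X + X] small modulo [u], and counting the
    integers of [X + X] above each residue gives a contradiction. *)

(** * Mann's theorem *)

(* Convertible but distinct canonical instances inside cardinals defeat [lia],
   so the cardinals in the goal are generalized first. *)
Ltac card_lia := clear; repeat (let n := fresh "n" in move: #|_| => n); lia.

Section Mann.
Local Open Scope group_scope.
Variables (gT : finGroupType).
Hypothesis cG : forall x y : gT, x * y = y * x.
Implicit Types (Q : {group gT}) (A B M X Y : {set gT}).

Lemma mulg_setC A B : A * B = B * A.
Proof.
by apply/setP=> z; apply/mulsgP/mulsgP=> -[x y xA yB ->]; exists y x.
Qed.

Lemma stableI Q A B : Q * A = A -> Q * B = B -> Q * (A :&: B) = A :&: B.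
Proof.
move=> QA QB; apply/eqP; rewrite eqEsubset mulG_subr andbT subsetI.
by apply/andP; split; [rewrite -[X in _ \subset pred_of_set X]QA | rewrite -[X in _ \subset pred_of_set X]QB];
  rewrite mulgS ?subsetIl ?subsetIr.
Qed.

(** Atom argument: the excess [#|Y * B| - #|Y|] is submodular in [Y]. If [M] met a different
    translate of itself, the intersection, being smaller than [M], would have larger excess, so the
    union would have smaller excess than [M]. Hence distinct translates of [M] are disjoint, and [M]
    is a coset of a group. *)
Lemma atom_group Q B M : Q * M = M -> M != set0 -> M * B != setT ->
    (forall Y, Q * Y = Y -> Y != set0 -> Y * B != setT ->
       #|M * B| + #|Y| <= #|Y * B| + #|M|) ->
    (forall Y, Q * Y = Y -> Y != set0 -> Y * B != setT ->
       #|M * B| + #|Y| = #|Y * B| + #|M| -> #|M| <= #|Y|) ->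
    #|M| + #|M * B| <= #|gT| ->
  exists Q' : {group gT},
    [/\ Q \subset Q', #|Q'| = #|M| & #|Q' * B| = #|M * B|].
Proof.
move=> QM M0 MB hmin hmin2 hdual.
have cMg X g : X :* g * B = (X * B) :* g.
  by rewrite -!mulgA (mulg_setC [set g]).
have key g : M :&: (M :* g) != set0 -> M :* g = M.
  move=> I0; apply/eqP; apply: contraT => ne.
  have QMg : Q * (M :* g) = M :* g by rewrite mulgA QM.
  have QI := stableI QM QMg.
  have cg : #|M :* g| = #|M| by rewrite card_rcoset.
  have ltI : #|M :&: M :* g| < #|M|.
    rewrite ltnNge; apply/negP=> le; move: ne.
    have /eqP IM : M :&: M :* g == M by rewrite eqEcard subsetIl.
    by rewrite eq_sym eqEcard cg leqnn andbT; move/setIidPl: IM => ->.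
  have sIB : (M :&: M :* g) * B \subset (M * B) :&: (M :* g * B).
    by rewrite subsetI !mulSg ?subsetIl ?subsetIr.
  have IB : (M :&: M :* g) * B != setT.
    apply: contraNN MB => /eqP IBT; rewrite eqEsubset subsetT -IBT.
    by rewrite mulSg ?subsetIl.
  have h1 := hmin _ QI I0 IB.
  have h2 : #|M * B| + #|M :&: M :* g| < #|(M :&: M :* g) * B| + #|M|.
    rewrite ltn_neqAle h1 andbT; apply/eqP=> /(hmin2 _ QI I0 IB).
    by rewrite leqNgt ltI.
  have cU := cardsUI M (M :* g).
  have cUB := cardsUI (M * B) (M :* g * B).
  have h3 := subset_leq_card sIB.
  have cgB : #|M :* g * B| = #|M * B| by rewrite cMg card_rcoset.
  (* The union is not a competitor if its product with [B] is everything; [hdual] excludes this by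
     counting. *)
  have [UT|UB] := eqVneq ((M :|: M :* g) * B) setT.
    have cT : #|M * B :|: M :* g * B| = #|gT| by rewrite -mulUg UT cardsT.
    by move: h2 h3 ltI hdual cUB cgB cT; card_lia.
  have QU : Q * (M :|: M :* g) = M :|: M :* g by rewrite mulgU QM QMg.
  have U0 : M :|: M :* g != set0.
    by apply: contraNN M0; rewrite setU_eq0 => /andP[].
  by have := hmin _ QU U0 UB; rewrite mulUg; move: h2 h3 cU cUB cg cgB; card_lia.
have /set0Pn[m mM] := M0.
pose M' := M :* m^-1.
have M1 : 1 \in M' by rewrite mem_rcoset invgK mul1g.
have gM : group_set M'.
  apply/group_setP; split=> // x y xM yM.
  have : M :* (m^-1 * y * m) = M.
    apply: key; apply/set0Pn; exists (y * m).
    rewrite inE; apply/andP; split; first by rewrite mem_rcoset invgK in yM.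
    by rewrite mem_rcoset !invMg !mulgA mulgK mulgV mul1g invgK.
  move=> eM; rewrite mem_rcoset invgK -eM mem_rcoset !invMg invgK.
  rewrite !mem_rcoset !invgK in xM yM *.
  by rewrite !mulgA -(mulgA _ m) mulgV mulg1 mulgK.
exists (Group gM); split=> /=.
- apply/subsetP=> q qQ; rewrite mem_rcoset invgK -QM.
  by apply/mulsgP; exists q m.
- by rewrite card_rcoset.
- by rewrite cMg card_rcoset.
Qed.

(* Mann's theorem; [Q] allows to apply it in the quotient by [Q] without
   forming the quotient. *)
Lemma mann Q A X : 1 \in A -> Q * A = A -> Q * X = X -> X != set0 ->
    X * A != setT -> #|X * A| + #|Q| < #|X| + #|A| ->
  exists Q' : {group gT}, [/\ Q \subset Q', Q' * A != setT &
    #|Q' * A| + #|Q| < #|Q'| + #|A| ].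
Proof.
move=> A1 QA QX X0 XA hX.
(* The excess is minimized over [A] and its inverse together, so that the complement of [M * op b]
   becomes a competitor of [M]. *)
pose op (b : bool) := if b then A else A^-1.
pose ok (c : bool * {set gT}) :=
  [&& Q * c.2 == c.2, c.2 != set0 & c.2 * op c.1 != setT].
have QAV b : Q * op b = op b.
  by case: b => //=; rewrite -[in RHS]QA invMg invGid mulg_setC.
have op1 b : 1 \in op b by case: b; rewrite //= inE invg1.
pose kap (c : bool * {set gT}) := #|c.2 * op c.1| - #|c.2|.
(* Lexicographic order: least excess first, then least size. *)
pose w c := kap c * #|gT|.+1 + #|c.2|.
have okX : ok (true, X) by rewrite /ok /= QX eqxx X0.
case: (arg_minnP w okX) => -[b M] okM wmin.
have [/eqP QM M0 MB] := and3P okM; rewrite /= in QM M0 MB.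
have sub Y b' : #|Y| <= #|Y * op b'|.
  by apply: subset_leq_card; rewrite mulG_subl // || apply/subsetP => y yY;
     apply/mulsgP; exists y 1; rewrite ?mulg1.
have kmin c : ok c -> kap (b, M) <= kap c /\
   (kap (b, M) = kap c -> #|M| <= #|c.2|).
  move=> okc; have := wmin _ okc; rewrite /w /=.
  have /= := max_card (mem M); have := max_card (mem c.2) => h1 h2 h3.
  move: h1 h2 h3; move: (kap _) (kap c) #|c.2| #|M| #|gT| => x y n1 n2 n h1 h2 h3.
  by split=> [|e]; nia.
pose D := ~: (M * op b).
have okD : ok (~~ b, D).
  apply/and3P; split=> /=.
  - rewrite eqEsubset mulG_subr andbT; apply/subsetP=> z /mulsgP[q y qQ].
    rewrite !inE => yD ->; apply: contraNN yD => qy.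
    rewrite -[y](mulKg q); rewrite -QM -mulgA; apply/mulsgP.
    by exists q^-1 (q * y); rewrite ?groupV.
  - apply: contraNN MB => /eqP e.
    by rewrite -(setCK (M * _)) -/D e setC0.
  - have /set0Pn[m mM] := M0; apply/negP=> /eqP e.
    have : m \in [set: gT] by [].
    rewrite -e => /mulsgP[d a dD aA em]; move: dD; rewrite !inE => /negP; apply.
    apply/mulsgP; exists m a^-1 => //; last by rewrite em mulgK.
    by move: aA; case: (b); rewrite /= ?inE ?invgK.
(* [D * op (~~ b)] misses [M], so the excess of [D] is at most that of [M], and minimality makes [D]
   at least as large. This is the last hypothesis of [atom_group]. *)
have dM : #|M| <= #|D|.
  have [h1 h2] := kmin _ okD; apply: h2; apply/eqP; rewrite eqn_leq h1 /=.
  have sD : D * op (~~ b) \subset ~: M.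
    apply/subsetP=> z /mulsgP[d a dD aA ->]; move: dD; rewrite !inE.
    apply: contraNN => dM; apply/mulsgP; exists (d * a) a^-1 => //.
      by move: aA; case: (b); rewrite /= ?inE ?invgK.
    by rewrite mulgK.
  have := subset_leq_card sD; have := cardsC M; have := cardsC (M * op b).
  have := sub M b; have := sub D (~~ b).
  by rewrite /kap /= -/D; card_lia.
have [|||Q' [sQ cQ cQB]] := @atom_group Q (op b) M QM M0 MB.
- move=> Y QY Y0 YB; have [|h _] := kmin (b, Y).
    by rewrite /ok /= QY eqxx Y0.
  by move: h; rewrite /kap /=; have := sub M b; have := sub Y b; card_lia.
- move=> Y QY Y0 YB e; have [|_ h] := kmin (b, Y).
    by rewrite /ok /= QY eqxx Y0.
  by apply: h; rewrite /kap /=; move: e; have := sub M b; have := sub Y b; card_lia.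
- by move: dM; have := cardsC (M * op b); rewrite -/D; card_lia.
have cop : #|Q' * op b| = #|Q' * A|.
  case: (b) => //=; rewrite -(card_invg (Q' * A)) invMg invGid mulg_setC //.
exists Q'; split=> //.
  apply: contraNN MB => /eqP QT; move: cQB.
  by rewrite cop QT cardsT => e; rewrite eqEcard subsetT cardsT -e /=.
have [h _] := kmin _ okX.
move: h; rewrite /kap /= -cop cQB cQ.
by move: hX; have := sub M b; have := sub X true => /=; card_lia.
Qed.

End Mann.

(** * Intervals in sumsets of integers *)

Definition cnt (P : pred nat) (a b : nat) : nat := \sum_(a <= i < b) P i.

Definition sumset (X Y : pred nat) : pred nat :=
  fun t => has (fun i => X i && Y (t - i)) (iota 0 t.+1).

Lemma sumsetP (X Y : pred nat) t :
  reflect (exists i j, [/\ X i, Y j & i + j = t]) (sumset X Y t).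
Proof.
apply: (iffP hasP) => [[i]|[i [j [Xi Yj <-]]]].
  rewrite mem_iota => /= it /andP[Xi Yi]; exists i, (t - i); split=> //; lia.
by exists i; rewrite ?mem_iota ?addKn ?Xi //=; lia.
Qed.

Lemma sumsetC X Y t : sumset X Y t = sumset Y X t.
Proof.
by apply/sumsetP/sumsetP => -[i [j [Xi Yj <-]]]; exists j, i; rewrite addnC.
Qed.

Lemma cnt_cat P a b c : a <= b -> b <= c -> cnt P a c = cnt P a b + cnt P b c.
Proof. by move=> ab bc; rewrite /cnt (big_cat_nat ab bc). Qed.

Lemma eq_cnt P Q a b : (forall i, a <= i < b -> P i = Q i) -> cnt P a b = cnt Q a b.
Proof. by move=> PQ; apply: eq_big_nat => i /PQ ->. Qed.

Lemma cnt_le P a b : cnt P a b <= b - a.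
Proof.
rewrite -[b - a]muln1 -sum_nat_const_nat; apply: leq_sum => i _; exact: leq_b1.
Qed.

Lemma sub_cnt P a b c d : c <= a -> b <= d -> cnt P a b <= cnt P c d.
Proof.
move=> ca bd; have [ab|ba] := leqP a b; last by rewrite /cnt big_geq // ltnW.
by rewrite (@cnt_cat _ c a d) ?(@cnt_cat _ a b d) //; lia.
Qed.

Lemma cnt0 P a b : (forall i, a <= i < b -> ~~ P i) -> cnt P a b = 0.
Proof. by move=> h; rewrite /cnt big_nat big1 // => i /h /negbTE ->. Qed.

Lemma cnt1 P a : cnt P a a.+1 = P a. Proof. by rewrite /cnt big_nat1. Qed.

Lemma cnt_shift P a b c : cnt (fun i => P (c + i)) a b = cnt P (c + a) (c + b).
Proof.
rewrite /cnt [in RHS]addnC [in RHS]big_addn addKn.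
by apply: eq_bigr => i _; rewrite addnC.
Qed.

Lemma cnt_rev (P : pred nat) a b c : b <= c.+1 ->
  \sum_(a <= z < b) P (c - z) = cnt P (c.+1 - b) (c.+1 - a).
Proof.
move=> bc; have [ab|ba] := leqP b a.
  by rewrite /cnt !big_geq //; lia.
rewrite /cnt -{1}[a]add0n big_addn -{1}[c.+1 - b]add0n big_addn.
rewrite (_ : c.+1 - a - (c.+1 - b) = b - a); last by lia.
rewrite big_nat_rev /=; apply: eq_big_nat => i hi; congr (nat_of_bool (P _)); lia.
Qed.

Lemma sum_bool_le (F G : nat -> bool) a b :
    (forall i, a <= i < b -> ~~ (F i && G i)) ->
  \sum_(a <= i < b) F i + \sum_(a <= i < b) G i <= b - a.
Proof.
move=> h; rewrite -big_split -[b - a]muln1 -sum_nat_const_nat /=.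
rewrite big_nat [leqRHS]big_nat; apply: leq_sum => i /h.
by case: (F i); case: (G i).
Qed.

Section Interval.
Variables (X Y : pred nat) (u : nat).
Hypotheses (Xu : forall i, X i -> i <= u) (Yu : forall i, Y i -> i <= u).
Hypotheses (X0 : X 0) (Y0 : Y 0) (Yuu : Y u).
Let S := sumset X Y.
Let x := cnt X 0 u.+1.
Let y := cnt Y 0 u.+1.
Hypothesis xy : u + 3 <= x + y.

(** [X] and [t - Y] are disjoint in [[0, t]]. The next lemma is the mirror image, with [u + t - Y]
    in [[t, u]]. *)
Lemma sumset_gap_low t : ~~ S t -> cnt X 0 t.+1 + cnt Y 0 t.+1 <= t.+1.
Proof.
move=> St; have := @sum_bool_le X (fun z => Y (t - z)) 0 t.+1.
rewrite cnt_rev // subnn subn0; apply=> i it.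
by apply: contraNN St => /andP[Xi Yi]; apply/sumsetP; exists i, (t - i); split=> //; lia.
Qed.

Lemma sumset_gap_high t : t <= u.+1 -> ~~ S (u + t) ->
  cnt X t u.+1 + cnt Y t u.+1 <= u.+1 - t.
Proof.
move=> tu St; have := @sum_bool_le X (fun z => Y (u + t - z)) t u.+1.
rewrite cnt_rev; last by lia.
rewrite (_ : (u + t).+1 - u.+1 = t); last by lia.
rewrite (_ : (u + t).+1 - t = u.+1); last by lia.
apply=> i it; apply: contraNN St => /andP[Xi Yi]; apply/sumsetP.
by exists i, (u + t - i); split=> //; lia.
Qed.

(** Two gaps in the same residue class modulo [u] would bound [x + y] by [u + 2]. *)
Lemma sumset_cover t : t <= u -> S t || S (u + t).
Proof.
move=> tu; apply: contraT; rewrite negb_or => /andP[].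
move=> /sumset_gap_low h1 /sumset_gap_high h2.
have := cnt_cat X (leq0n t) (leq_trans tu (leqnSn u)).
have := cnt_cat Y (leq0n t) (leq_trans tu (leqnSn u)).
have := sub_cnt X (leq0n 0) (leqnSn t); have := sub_cnt Y (leq0n 0) (leqnSn t).
by move: h1 h2 xy; rewrite /x /y; lia.
Qed.

Let E t := [&& S t, S (u + t) & ~~ X t].

(** Each residue modulo [u] has a lift in [S] by [sumset_cover]; those of [X] have two because [0]
    and [u] are in [Y], and those of [E] have two as well. *)
Lemma sumset_card : u + x + cnt E 1 u <= cnt S 0 (u + u).+1.
Proof.
have u0 : 0 < u by have := cnt_le X 0 u.+1; have := cnt_le Y 0 u.+1; move: xy; rewrite /x /y; lia.
have XS t : X t -> S t && S (u + t).
  move=> Xt; apply/andP; split; apply/sumsetP.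
    by exists t, 0; rewrite addn0.
  by exists t, u; rewrite addnC.
rewrite (@cnt_cat S 0 u) //; last by lia.
rewrite (@cnt_cat S u (u + u)) //; try lia.
have -> : cnt S u (u + u) = cnt (fun i => S (u + i)) 0 u by rewrite cnt_shift addn0.
rewrite cnt1 (@cnt_cat _ 0 1 u) // (@cnt_cat (fun i => S (u + i)) 0 1 u) //.
rewrite !cnt1 addn0.
have -> : S 0 by have /andP[] := XS _ X0.
have -> : S u by have /andP[_] := XS _ X0; rewrite addn0.
have hx : x = 1 + cnt X 1 u + X u.
  by rewrite /x (@cnt_cat _ 0 1) // (@cnt_cat _ 1 u) // !cnt1 X0; lia.
have hu : X u <= S (u + u) by case: (boolP (X u)) => // /XS /andP[_ ->].
have : (u - 1) + cnt X 1 u + cnt E 1 u <= cnt S 1 u + cnt (fun i => S (u + i)) 1 u.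
  rewrite -[u - 1]muln1 -sum_nat_const_nat /cnt -!big_split /=.
  rewrite big_nat [leqRHS]big_nat; apply: leq_sum => i iu.
  have := @sumset_cover i; have := XS i; rewrite /E.
  case: (X i) => /=; first by move=> /(_ isT) /andP[-> ->].
  by move=> _ /(_ _); case: (S i); case: (S (u + i)) => //=; lia.
by rewrite hx; lia.
Qed.

Hypothesis small : cnt S 0 (u + u).+1 + 4 <= y + 2 * x.

(* A closest pair with [e1 < e0] would force
   [(e0 - Y) :|: (e1 + u - Y)] into the complement of [X], with overlap only
   at residues counted by [E]. *)
Lemma sumset_gaps_ordered e0 e1 : e0 <= u -> 0 < e1 -> ~~ S e0 -> ~~ S (u + e1) -> e0 < e1.
Proof.
move=> e0u e10 Se0 Se1; rewrite ltnNge; apply/negP=> le.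
have : exists d, [exists e : 'I_u.+1, [&& 0 < e, e + d <= u, ~~ S (e + d) & ~~ S (u + e)]].
  exists (e0 - e1); apply/existsP; exists (inord e1).
  by rewrite inordK ?e10 ?subnKC ?Se0 ?Se1 ?e0u //; lia.
case/ex_minnP=> d /existsP[[e eu] /= /and4P[e0' edu Sed Sue]] dmin.
have closest d' e' : 0 < e' -> e' + d' <= u -> ~~ S (e' + d') -> ~~ S (u + e') -> d <= d'.
  move=> h1 h2 h3 h4; apply: dmin; apply/existsP.
  have e'u : e' < u.+1 by rewrite ltnS (leq_trans (leq_addr d' e')).
  by exists (Ordinal e'u); rewrite /= h1 h2 h3.
clear dmin le e10 Se1 e1 Se0 e0u e0.
have Su : S u by apply/sumsetP; exists 0, u.
have edu' : e + d < u by rewrite ltn_neqAle edu andbT; apply: contraNneq Sed => ->.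
(* Inside the overlap, minimality of [d] puts both lifts of [z] in [S], except at the endpoints [e]
   and [e + d], which the last two terms pay for. *)
have pw z : z < u.+1 ->
    ((z <= e + d) && Y (e + d - z)) + ((e <= z) && Y (u + e - z)) + X z <=
    1 + ((0 < z < u) && E z) * (z != e) * (z != e + d) + (z == e) + (z == e + d).
  move=> zu.
  have h1 : (z <= e + d) && Y (e + d - z) -> ~~ X z.
    move=> /andP[zd Yz]; apply: contraNN Sed => Xz; apply/sumsetP.
    by exists z, (e + d - z); split=> //; lia.
  have h2 : (e <= z) && Y (u + e - z) -> ~~ X z.
    move=> /andP[zd Yz]; apply: contraNN Sue => Xz; apply/sumsetP.
    by exists z, (u + e - z); split=> //; lia.
  case: (boolP (_ && _)) h1 => [/andP[zd _] /(_ isT) Xz|_ _]; last first.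
    by case: (boolP (_ && _)) h2 => [_ /(_ isT) /negbTE ->|_ _]; case: (X z) => //=; lia.
  case: (boolP (_ && _)) h2 => [/andP[ez _] _|_ _]; rewrite (negbTE Xz); last by lia.
  have [->|ze] := eqVneq z e; first by lia.
  have [->|zde] := eqVneq z (e + d); first by lia.
  rewrite /E Xz andbT.
  have -> : 0 < z < u by lia.
  have ze' : e <= z := ez.
  case: (boolP (S z)) => [_|Sz]; last first.
    have : d <= z - e by apply: (closest _ e); rewrite ?subnKC //; lia.
    by clear closest; lia.
  case: (boolP (S (u + z))) => [_ //|Suz].
  have : d <= e + d - z by apply: (closest _ z); rewrite ?subnKC //; lia.
  by clear closest; lia.
have : \sum_(0 <= z < u.+1) (((z <= e + d) && Y (e + d - z)) + ((e <= z) && Y (u + e - z)) + X z) <=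
   \sum_(0 <= z < u.+1) (1 + ((0 < z < u) && E z) + (z == e) + (z == e + d)).
  rewrite big_nat [leqRHS]big_nat; apply: leq_sum => z zu.
  apply: leq_trans (pw z _) _; first by lia.
  have h (b1 b2 b3 : bool) : b1 * b2 * b3 <= b1 by case: b1 b2 b3 => [] [] [].
  by rewrite !leq_add2r leq_add2l h.
rewrite !big_split /= sum_nat_const_nat subn0 muln1.
have eqsum c : c < u.+1 -> \sum_(0 <= z < u.+1) (z == c) = 1.
  move=> cu; rewrite big_mkord (bigD1 (Ordinal cu)) //= eqxx big1 // => i.
  by rewrite -val_eqE /= => /negbTE ->.
rewrite (eqsum e) // (eqsum (e + d)) ?ltnS //.
have -> : \sum_(0 <= z < u.+1) ((0 < z < u) && E z) = cnt E 1 u.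
  rewrite -/(cnt (fun z => (0 < z < u) && E z) 0 u.+1) (@cnt_cat _ 0 1) // (@cnt_cat _ 1 u) ?cnt1 ?ltnn ?andbF /=; try lia.
  by rewrite !addn0 add0n; apply: eq_cnt => i ->.
have -> : \sum_(0 <= z < u.+1) ((z <= e + d) && Y (e + d - z)) = cnt Y 0 (e + d).+1.
  rewrite -/(cnt (fun z => (z <= e + d) && Y (e + d - z)) 0 u.+1) (@cnt_cat _ 0 (e + d).+1) //.
  rewrite [cnt _ (e + d).+1 _]cnt0 ?addn0; last by move=> i; lia.
  rewrite (@eq_cnt _ (fun z => Y (e + d - z))); last by move=> i /andP[_]; rewrite ltnS => ->.
  by rewrite /cnt cnt_rev // subnn.
have -> : \sum_(0 <= z < u.+1) ((e <= z) && Y (u + e - z)) = cnt Y e u.+1.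
  rewrite -/(cnt (fun z => (e <= z) && Y (u + e - z)) 0 u.+1) (@cnt_cat _ 0 e u.+1) // ?(ltnW eu) //.
  rewrite [cnt _ 0 e]cnt0 ?add0n; last by move=> i; lia.
  rewrite (@eq_cnt _ (fun z => Y (u + e - z))); last by move=> i /andP[->].
  rewrite /cnt cnt_rev; last by lia.
  by congr cnt; lia.
have := @cnt_cat Y 0 e u.+1 (leq0n _) (ltnW eu).
have := @sub_cnt Y 0 e 0 (e + d).+1 (leqnn _).
have := sumset_card; move: small; rewrite -/x -/(cnt X 0 u.+1) -/y -/x.
by move: (cnt E 1 u) (cnt S 0 _) (cnt Y 0 _) (cnt Y 0 e) (cnt Y e _); lia.
Qed.

(** The run of [S] through [u] is long enough. Let it start at [st] and let [u + e] be the first gap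
    after it. Since [st <= e] by [sumset_gaps_ordered], the gap bounds below [st] and from [e] on,
    with the trivial bound in between, give [x + y <= u + e - st + 1]. *)
Lemma sumset_interval : exists st, forall t, st <= t < st + (x + y - 1) -> S t.
Proof.
have Su : S u by apply/sumsetP; exists 0, u.
have : exists st, (st <= u) && all S (iota st (u.+1 - st)).
  by exists u; rewrite leqnn subSnn /= Su.
case/ex_minnP=> st /andP[stu /allP Sst] stmin.
have : exists e, (0 < e) && ~~ S (u + e).
  exists u.+1; rewrite /=; apply/negP=> /sumsetP[i [j [/Xu + /Yu]]]; lia.
case/ex_minnP=> e /andP[e0 Sue] emin.
have eu : e <= u.+1.
  apply: emin; rewrite /=; apply/negP=> /sumsetP[i [j [/Xu + /Yu]]]; lia.
have low : cnt X 0 st + cnt Y 0 st <= st.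
  case: st stu Sst stmin => [|s] su Sst stmin; first by rewrite /cnt !big_geq.
  apply: sumset_gap_low; apply/negP=> Ss.
  have : s.+1 <= s; last by lia.
  apply: stmin; rewrite (ltnW su) /=; apply/allP=> i.
  rewrite mem_iota => hi; have [->//|ne] := eqVneq i s.
  by apply: Sst; rewrite mem_iota; lia.
have high := sumset_gap_high eu Sue.
have ste : st <= e.
  case: st stu Sst stmin low => [//|s] su Sst stmin _.
  apply: sumset_gaps_ordered => //; first by lia.
  apply/negP=> Ss; have : s.+1 <= s; last by lia.
  apply: stmin; rewrite (ltnW su) /=; apply/allP=> i.
  rewrite mem_iota => hi; have [->//|ne] := eqVneq i s.
  by apply: Sst; rewrite mem_iota; lia.
exists st => t ht.
have len : x + y <= u + e - st + 1.
  have := cnt_cat X (leq0n st) (leq_trans ste eu).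
  have := cnt_cat Y (leq0n st) (leq_trans ste eu).
  have := cnt_cat X ste eu; have := cnt_cat Y ste eu.
  by have := cnt_le X st e; have := cnt_le Y st e; rewrite /x /y; lia.
have [tu|ut] := leqP t u; first by apply: Sst; rewrite mem_iota; lia.
apply: contraT => St; have : e <= t - u; last by lia.
by apply: emin; rewrite subnKC ?St; lia.
Qed.

End Interval.

(** * Freiman's 3k-4 theorem *)

Lemma stable_dvd (gT : finGroupType) (Q : {group gT}) (A : {set gT}) :
  (Q * A = A -> #|Q| %| #|A|)%g.
Proof.
move=> QA; have pP := preim_partitionP (rcoset Q) A.
apply/dvdnP; exists #|preim_partition (rcoset Q) A|.
apply: (card_uniform_partition _ pP) => _ /imsetP[x xA ->].
rewrite -(card_rcoset Q x); apply: eq_card => y.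
rewrite inE !rcosetE (sameP eqP rcoset_eqP) rcoset_sym; apply/andb_idl.
by apply/subsetP; rewrite -QA mulgS // sub1set.
Qed.

(** With [a] the least element of [P] and [b] the largest of [Q], the translates [a + Q] and [P + b]
    meet only in [a + b]. *)
Lemma cnt_sumset_ge (P Q : pred nat) (N x y : nat) : P x -> Q y ->
    (forall i, P i -> i < N) -> (forall i, Q i -> i < N) ->
  cnt P 0 N + cnt Q 0 N <= (cnt (sumset P Q) 0 (N + N)).+1.
Proof.
move=> Px Qy PN QN.
have exP : exists x, P x by exists x.
have exQ : exists y, Q y by exists y.
case: (ex_minnP exP) => a Pa amin.
have ubQ i : Q i -> i <= N by move/QN/ltnW.
case: (ex_maxnP exQ ubQ) => b Qb bmax.
have aN := PN _ Pa; have bN := QN _ Qb.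
rewrite (@cnt_cat _ 0 a) ?(ltnW aN) // [cnt P 0 a]cnt0 ?add0n; last first.
  by move=> i ia; apply/negP => /amin; lia.
rewrite (@cnt_cat _ a a.+1) // cnt1 Pa.
rewrite (@cnt_cat Q 0 b.+1) // [cnt Q b.+1 N]cnt0 ?addn0; last first.
  by move=> i ib; apply/negP => /bmax; lia.
rewrite (@cnt_cat (sumset P Q) 0 (a + b).+1); try lia.
have h1 : cnt Q 0 b.+1 <= cnt (sumset P Q) 0 (a + b).+1.
  apply: leq_trans (sub_cnt _ (leq0n a) (leqnn _)).
  rewrite -addnS -{1}[a]addn0 -cnt_shift; apply: leq_sum => i _.
  by case: (boolP (Q i)) => // Qi; rewrite lt0b; apply/sumsetP; exists a, i.
have h2 : cnt P a.+1 N <= cnt (sumset P Q) (a + b).+1 (N + N).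
  apply: (@leq_trans (cnt (sumset P Q) (a + b).+1 (b + N))); last first.
    by apply: sub_cnt; lia.
  rewrite addnC -addnS -cnt_shift; apply: leq_sum => i _.
  by case: (boolP (P i)) => // Pi; rewrite lt0b; apply/sumsetP; exists i, b; rewrite addnC.
lia.
Qed.


(* [A] stands for the residues modulo [u] of a set [X] of integers with minimum
   [0] and maximum [u], and [rho r] for the number of elements of [X + X], other
   than [2 u], in the residue class [r]. *)
Section Lifts.
Local Open Scope group_scope.
Variables (gT : finGroupType).
Hypothesis cG : forall x y : gT, x * y = y * x.
Variables (A : {set gT}) (rho : gT -> nat).
Hypothesis A1 : 1 \in A.
Hypothesis prim : forall Q : {group gT}, A \subset Q -> Q = [set: gT] :> {set gT}.
Hypothesis A_lifts : forall r, r \in A -> (1 < rho r)%N.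
Hypothesis AA_lifts : forall r, r \in A * A -> (0 < rho r)%N.
Hypothesis coset_lifts : forall (Q : {group gT}) c1 c2, c1 \in A -> c2 \in A ->
  (#|A :&: (Q :* c1)| + #|A :&: (Q :* c2)| <=
     (\sum_(r : gT) (r \in Q :* (c1 * c2)) * rho r).+1)%N.
Let N := #|A|.
Hypothesis sparse : (2 * N <= #|gT|)%N.
Hypothesis small : (\sum_(r : gT) rho r + 2 <= 3 * N)%N.

Lemma sum_mem (B : {set gT}) : \sum_(r : gT) (r \in B) = #|B|.
Proof. by rewrite -sum1_card [RHS]big_mkcond; apply: eq_bigr => r _; case: (_ \in _). Qed.

Lemma mulg_card_small : (#|(A * A)%g| + 2 <= 2 * N)%N.
Proof.
have : (#|(A * A)%g| + N <= \sum_(r : gT) rho r)%N.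
  rewrite -(sum_mem (A * A)) /N -(sum_mem A) -big_split; apply: leq_sum => r _ /=.
  have := @AA_lifts r; have := @A_lifts r.
  by case: (r \in A) => [/(_ isT) h _|_]; case: (_ \in _) => //=; [lia | move=> /(_ isT)].
by move: small; lia.
Qed.

Let deficient (Q : {group gT}) :=
  (Q * A != setT) && (#|(Q * A)%g| + 1 < #|Q| + N)%N.

Lemma ex_deficient : exists Q, deficient Q.
Proof.
have A0 : A != set0 by apply/set0Pn; exists 1; apply: A1.
have [||Q' [_ h1 h2]] := @mann _ cG 1%G A A A1 (mul1g _) (mul1g _) A0.
- apply/eqP=> e; have := mulg_card_small; have := cardsT gT; rewrite -e.
  by have := sparse; card_lia.
- by rewrite cards1; have := mulg_card_small; rewrite /N; card_lia.
by exists Q'; rewrite /deficient h1 /=; move: h2; rewrite cards1.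
Qed.

(** Take [Q] a largest deficient subgroup and [B = Q A]. Since [A] nearly fills [B], the pigeonhole
    principle puts [B B], outside [Q] and one further coset [K], inside [A A]. Counting lifts with
    [coset_lifts] on [K] and with [A_lifts] and [AA_lifts] elsewhere yields at least [3 N - 1] of
    them, against [small]. *)
Lemma lifts_not_sparse : False.
Proof.
have [Q1 dQ1] := ex_deficient.
case: (arg_maxnP (fun Q : {group gT} => #|Q|) dQ1) => Q /andP[QAT dQ] Qmax.
set B := Q * A in QAT dQ.
have QB : Q * B = B by rewrite mulgA mulGid.
have B1 : 1 \in B by apply/mulsgP; exists 1 1; rewrite ?A1 ?mulg1.
have B0 : B != set0 by apply/set0Pn; exists 1.
have sAB : A \subset B by apply: mulG_subr.
have sQB : Q \subset B.
  by apply/subsetP=> q qQ; apply/mulsgP; exists q 1; rewrite ?A1 ?mulg1.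
have QBB : Q * (B * B) = B * B by rewrite mulgA QB.
have BBeq : B * B = Q * (A * A).
  by rewrite /B mulgA -(mulgA Q) (mulg_setC cG A) !mulgA mulGid.
have sBBB : B \subset B * B.
  by apply/subsetP=> q qQ; apply/mulsgP; exists q 1; rewrite ?mulg1.
have Q0 := cardG_gt0 Q.
have NB : (N <= #|B|)%N by apply: subset_leq_card.
(* If [B B] is everything, sparseness and divisibility by [#|Q|] suffice. Otherwise a failure gives,
   by Mann's theorem above [Q], a deficient group containing [Q]; by maximality it is [Q] itself,
   which contradicts the strict inequality. *)
have BBge : (2 * #|B| <= #|(B * B)%g| + #|Q|)%N.
  have [BBT|BBT] := eqVneq (B * B) setT.
    have /dvdnP[b eb] := stable_dvd QB; have /dvdnP[c ec] := stable_dvd QBB.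
    have e : #|(B * B)%g| = #|gT| by rewrite BBT cardsT.
    have N0 : (0 < N)%N by apply/card_gt0P; exists 1; apply: A1.
    have := sparse; rewrite -e ec; move: dQ Q0 NB N0; rewrite eb.
    move: (#|Q|) (N) => q m; clear; case: b => [|b]; first by lia.
    rewrite mulSn => h1 h2 h3 h4 h5.
    have : (2 * b * q < c * q)%N by lia.
    rewrite ltn_mul2r => /andP[_ h6].
    by have := leq_mul2r q (2 * b).+1 c; rewrite h6 orbT; lia.
  rewrite leqNgt; apply/negP=> lt.
  have [|Q' [sQ Q'B h]] := mann cG B1 QB QB B0 BBT; first by move: lt; card_lia.
  have eQ' : Q' * B = Q' * A by rewrite mulgA mulGSid.
  rewrite eQ' in Q'B h.
  have : (#|Q'| <= #|Q|)%N.
    by apply: Qmax; rewrite /deficient Q'B /=; move: h dQ; card_lia.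
  move=> le; have e : Q = Q' :> {set gT} by apply/eqP; rewrite eqEcard sQ.
  by move: h; rewrite -e -/B; card_lia.
have QnB : (#|Q| < #|B|)%N.
  rewrite ltn_neqAle subset_leq_card // andbT; apply/negP=> /eqP e.
  have eQB : Q = B :> {set gT} by apply/eqP; rewrite eqEcard sQB e leqnn.
  by move: QAT; rewrite -/B -eQB (prim (Q := Q)) ?eqxx // eQB.
pose m c := #|A :&: (Q :* c)|.
(* [A] meets [Q b] in [m b] points and [r (A :&: Q c)^-1] has [m c] points, all in [Q b]; if they
   were disjoint, [m b + m c] would be at most [#|Q|]. *)
have pig b c r : r \in Q :* (b * c) -> (#|Q| < m b + m c)%N -> r \in A * A.
  move=> rbc; apply: contraTT => rA; rewrite -leqNgt.
  pose V := r *: (A :&: (Q :* c))^-1.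
  have <- : #|V| = m c by rewrite card_lcoset card_invg.
  rewrite -(card_rcoset Q b) -leq_subRL; last first.
    by apply: subset_leq_card; apply: subsetIr.
  have sV : V \subset Q :* b :\: A.
    apply/subsetP=> z /lcosetP[y']; rewrite mem_invg => /setIP[yA yc] ->.
    rewrite in_setD; apply/andP; split.
      by apply: contraNN rA => h; apply/mulsgP; exists (r * y') y'^-1; rewrite ?mulgK.
    rewrite mem_rcoset in rbc; rewrite mem_rcoset in yc; rewrite mem_rcoset.
    have -> : r * y' * b^-1 = (r * (b * c)^-1) * (y'^-1 * c^-1)^-1.
      rewrite !invMg !invgK (cG c^-1) !mulgA mulgKV.
      by rewrite -!mulgA; congr (r * _); apply: cG.
    by rewrite groupM ?groupV.
  apply: leq_trans (subset_leq_card sV) _.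
  by rewrite cardsD setIC.
have cQB c : c \in B -> Q :* c \subset B.
  by move=> cB; rewrite -QB mulgS // sub1set.
have one c : c \in B -> (#|Q| + N <= m c + #|B|)%N.
  move=> /cQB sc; rewrite -(card_rcoset Q c) /N /m.
  have := cardsID (Q :* c) A; have := cardsID (Q :* c) B.
  rewrite (setIidPr sc); have := subset_leq_card (setSD (Q :* c) sAB).
  by card_lia.
have two b c : b \in B -> c \in B -> Q :* b != Q :* c ->
    (2 * #|Q| + N <= m b + m c + #|B|)%N.
  move=> /cQB sb /cQB sc ne.
  have dis : Q :* b :&: Q :* c = set0.
    apply/eqP; apply: contraNT ne => /set0Pn[z]; rewrite inE => /andP[zb zc].
    by rewrite -(rcoset_eqP zb) -(rcoset_eqP zc).
  have := cardsUI (Q :* b) (Q :* c); rewrite dis cards0 !card_rcoset addn0.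
  have := cardsUI (A :&: Q :* b) (A :&: Q :* c).
  rewrite setIACA dis setI0 cards0 addn0 -setIUr /N /m.
  have sU : Q :* b :|: Q :* c \subset B by rewrite subUset sb.
  have := cardsID (Q :* b :|: Q :* c) A; have := cardsID (Q :* b :|: Q :* c) B.
  rewrite (setIidPr sU).
  have := subset_leq_card (setSD (Q :* b :|: Q :* c) sAB).
  by card_lia.
have BAc b : b \in B -> exists2 c, c \in A & b \in Q :* c.
  by case/mulsgP=> q c qQ cA ->; exists c => //; rewrite mem_rcoset mulgK.
have BBAc r : r \in B * B -> exists b c, [/\ b \in A, c \in A & r \in Q :* (b * c)].
  rewrite BBeq => /mulsgP[q r' qQ /mulsgP[b c bA cA ->] ->].
  by exists b, c; split=> //; rewrite mem_rcoset mulgK.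
have AB := subsetP sAB.
(* A point of [B B] outside [A A] lies in [Q b b] for a coset [Q b] at most half filled by [A]. By
   [two] there is only one such coset. If no such point lies outside [B], any coset of [B B] outside
   [B] serves. *)
have [c1 [c2 [c1A c2A c12 full]]] : exists c1 c2, [/\ c1 \in A, c2 \in A, c1 * c2 \notin B &
    forall r, r \in B * B -> r \notin B -> r \notin A * A -> r \in Q :* (c1 * c2)].
  have notB b c r : r \in Q :* (b * c) -> r \notin B -> b * c \notin B.
    move=> rbc; apply: contraNN => /cQB /subsetP; exact.
  have big r b c : r \notin A * A -> r \in Q :* (b * c) -> b \in A -> c \in A ->
      Q :* b = Q :* c /\ (2 * m b <= #|Q|)%N.
    move=> rA rbc bA cA.
    have h : (m b + m c <= #|Q|)%N by rewrite leqNgt; apply: contraNN rA; apply: pig.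
    have [e|ne] := eqVneq (Q :* b) (Q :* c).
      by split=> //; move: h; rewrite /m -e mul2n addnn.
    by have := two _ _ (AB _ bA) (AB _ cA) ne; move: h dQ; card_lia.
  case: (boolP [exists r, (r \in B * B) && (r \notin B) && (r \notin A * A)]).
    case/existsP=> r /andP[/andP[rBB rB] rA].
    have [b [c [bA cA rbc]]] := BBAc _ rBB.
    exists b, c; split=> //; first exact: notB rbc rB.
    move=> s sBB sB sA; have [b' [c' [bA' cA' sbc]]] := BBAc _ sBB.
    have [e h] := big _ _ _ rA rbc bA cA.
    have [e' h'] := big _ _ _ sA sbc bA' cA'.
    have [eb|ne] := eqVneq (Q :* b) (Q :* b'); last first.
      by have := two _ _ (AB _ bA) (AB _ bA') ne; move: h h' dQ Q0; card_lia.
    have mulQ x y : Q :* x * (Q :* y) = Q :* (x * y).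
      by rewrite mulgA -(mulgA Q) (mulg_setC cG [set x]) mulgA mulGid -mulgA mulg_set1 cG.
    by rewrite -mulQ -e eb {2}e' mulQ.
  rewrite negb_exists => /forallP nf.
  have /existsP[r /andP[rBB rB]] : [exists r, (r \in B * B) && (r \notin B)].
    apply: contraT; rewrite negb_exists => /forallP h.
    have : (#|(B * B)%g| <= #|B|)%N.
      by apply: subset_leq_card; apply/subsetP=> z zBB; have := h z; rewrite zBB /= negbK.
    by move: BBge QnB; card_lia.
  have [b [c [bA cA rbc]]] := BBAc _ rBB.
  exists b, c; split=> //; first exact: notB rbc rB.
  by move=> s sBB sB sA; have := nf s; rewrite sBB sB sA.
pose K := Q :* (c1 * c2).
have KB r : r \in K -> r \notin B.
  move=> rK; apply: contraNN c12 => /cQB /subsetP; apply.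
  by rewrite rcoset_sym.
have KBB : K \subset B * B.
  by rewrite BBeq mulgS // sub1set; apply/mulsgP; exists c1 c2.
(* Pointwise in [r]: two lifts on [A], one on the rest of [B B]; nothing is claimed on the rest of
   [Q], and on [K] the lifts are kept as they are. *)
have main : (\sum_(r : gT) (r \in K) * rho r + #|(B * B)%g| + #|A| + #|A :&: Q| <=
             \sum_(r : gT) rho r + #|Q| + #|K|)%N.
  rewrite -(sum_mem (B * B)) -(sum_mem A) -(sum_mem (A :&: Q)) -(sum_mem Q) -(sum_mem K).
  rewrite -!big_split; apply: leq_sum => r _ /=.
  have [rK|rK] := boolP (r \in K).
    have rB := KB _ rK; have rBB : r \in B * B by apply: (subsetP KBB).
    have rA : (r \in A) = false by apply: contraNF rB; apply: AB.
    have rQ : (r \in Q) = false by apply: contraNF rB; apply: (subsetP sQB).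
    by rewrite in_setI rA rQ rBB mul1n !addn0.
  rewrite mul0n add0n addn0 inE.
  have [rA|rA] := boolP (r \in A).
    have h := A_lifts rA; rewrite (subsetP sBBB _ (AB _ rA)) andTb leq_add2r.
    by rewrite addn1.
  have [rQ|rQ] := boolP (r \in Q).
    by rewrite andFb !addn0 (leq_trans (leq_b1 _)) ?leq_addl.
  have [rBB|//] := boolP (r \in B * B); rewrite !addn0.
  apply: AA_lifts.
  have [rB|rB] := boolP (r \in B); last first.
    by apply: contraT => h; move: rK; rewrite full.
  have [c cA rc] := BAc _ rB.
  apply: (@pig 1 c); first by rewrite mul1g.
  have ne : Q :* 1 != Q :* c.
    by apply: contraNN rQ => /eqP; rewrite mulg1 => ->.
  by have := two _ _ B1 (AB _ cA) ne; move: dQ; card_lia.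
have ne1 : Q :* 1 != Q :* c1.
  apply: contraNN c12 => /eqP; rewrite mulg1 => e.
  have c1Q : c1 \in Q by rewrite e rcoset_refl.
  by rewrite -QB; apply/mulsgP; exists c1 c2; rewrite ?AB.
have h2 := two _ _ B1 (AB _ c1A) ne1; rewrite {1}/m mulg1 in h2.
move: h2; have := one _ (AB _ c2A).
have sumK := coset_lifts Q c1A c2A.
rewrite -/K -/(m c1) -/(m c2) in sumK.
have cK : #|K| = #|Q| by rewrite card_rcoset.
move: main; rewrite cK -/N.
move: sumK small BBge; rewrite -/K.
move: (\sum_(r : gT) (r \in K) * rho r)%N (\sum_(r : gT) rho r)%N => s s'.
by move: (m c1) (m c2); card_lia.
Qed.

End Lifts.

(** * Reduction of a set of integers modulo its maximum *)

Section Freiman.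
Local Open Scope group_scope.
Variables (u' : nat) (X : pred nat).
Let u := u'.+1.
Hypotheses (Xu : forall i, X i -> (i <= u)%N) (X0 : X 0) (Xuu : X u).
Let n := cnt X 0 u.+1.
Let S := sumset X X.
Hypothesis prim : forall d, (1 < d)%N -> exists2 x, X x & ~~ (d %| x).
Hypothesis small : (cnt S 0 (u + u).+1 + 4 <= 3 * n)%N.

Local Notation G := 'I_u'.+1.
Let A : {set G} := [set r : G | X r].
Let N := #|A|.

Lemma card_residues (P : pred nat) : #|[set r : G | P r]| = cnt P 0 u.
Proof.
by rewrite /cnt big_mkord -sum1_card big_mkcond /=; apply: eq_bigr => i _; rewrite inE; case: (P i).
Qed.

Lemma Zp_commute (x y : G) : x * y = y * x. Proof. exact: Zp_mulgC. Qed.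

Lemma inZpM x y : (inZp (x + y) : G) = inZp x * inZp y.
Proof. by apply: val_inj; rewrite /= modnDm. Qed.

Lemma inZpD_u (r : G) : (inZp (u + r) : G) = r.
Proof. by apply: val_inj; rewrite /= modnDl modn_small. Qed.

Lemma inZp_val (r : G) : (inZp r : G) = r. Proof. exact: valZpK. Qed.

Lemma cnt_residues : n = N.+1.
Proof. by rewrite /n (@cnt_cat _ 0 u) // cnt1 Xuu addn1 /N card_residues. Qed.

Lemma residues1 : 1 \in A. Proof. by rewrite inE. Qed.

Lemma residues_lifts (r : G) : r \in A -> S r && S (u + r).
Proof.
rewrite inE => Xr; apply/andP; split; apply/sumsetP.
  by exists r, 0%N; rewrite addn0.
by exists r, u; rewrite addnC.
Qed.

Lemma sumset_mod (P Q : pred nat) x y : x < u -> y < u -> P x -> Q y ->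
  sumset P Q ((x + y) %% u) || sumset P Q (u + (x + y) %% u).
Proof.
move=> xu yu Px Qy; have [xyu|uxy] := ltnP (x + y) u.
  by rewrite modn_small //; apply/orP; left; apply/sumsetP; exists x, y.
rewrite (_ : (x + y) %% u = (x + y - u)%N).
  by apply/orP; right; apply/sumsetP; exists x, y; split=> //; lia.
by rewrite -{1}(subnKC uxy) modnDl modn_small //; lia.
Qed.

Lemma residues_mul_lift (r : G) : r \in A * A -> S r || S (u + r).
Proof.
case/mulsgP=> x y; rewrite !inE => Xx Xy er.
have -> : nat_of_ord r = (x + y) %% u by rewrite er.
exact: sumset_mod (ltn_ord x) (ltn_ord y) Xx Xy.
Qed.

Let rho (r : G) : nat := S r + S (u + r).

Lemma sum_lifts : cnt S 0 (u + u).+1 = (\sum_(r : G) rho r).+1.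
Proof.
rewrite (@cnt_cat S 0 u); try lia; rewrite (@cnt_cat S u (u + u)); try lia.
have -> : cnt S u (u + u) = cnt (fun i => S (u + i)) 0 u by rewrite cnt_shift addn0.
rewrite cnt1 (_ : S (u + u)); last by apply/sumsetP; exists u, u.
by rewrite addnA addn1 /cnt !big_mkord -big_split.
Qed.

Lemma residues_generate (Q : {group G}) : A \subset Q -> Q = [set: G] :> {set G}.
Proof.
move=> AQ; apply/eqP; apply: contraT => QT.
have /dvdnP[d ed] : #|Q| %| u by rewrite -(card_ord u) -cardsT cardSg ?subsetT.
have d1 : (1 < d)%N.
  have : (#|Q| < u)%N.
    by rewrite -(card_ord u) -cardsT proper_card // properT.
  by rewrite ed -{1}[#|Q|]mul1n ltn_mul2r => /andP[].
have [x Xx /negP[]] := prim d1.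
have [->|xu] := eqVneq x u; first by rewrite ed dvdn_mulr.
have ltxu : (x < u)%N by rewrite ltn_neqAle xu Xu.
have xQ : (Ordinal ltxu : G) \in Q by rewrite (subsetP AQ) // inE.
have : (Ordinal ltxu : G) ^+ #|Q| = 1 by apply: expg_cardG.
rewrite Zp_expg => /(congr1 val) /= e2.
have : u %| x * #|Q| by rewrite /dvdn e2.
by rewrite ed dvdn_pmul2r.
Qed.

(** [cnt_sumset_ge] is applied to the representatives in [[0, u)] of the two coset parts; their sums
    are elements of [S] below [2 u] with residue in [K]. *)
Lemma residues_coset_lifts (Q : {group G}) c1 c2 : c1 \in A -> c2 \in A ->
  (#|A :&: (Q :* c1)| + #|A :&: (Q :* c2)| <=
     (\sum_(r : G) (r \in Q :* (c1 * c2)) * rho r).+1)%N.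
Proof.
move=> c1A c2A; pose m c := #|A :&: (Q :* c)|; rewrite -/(m c1) -/(m c2).
pose K := Q :* (c1 * c2); rewrite -/K.
pose P c x := [&& (x < u)%N, X x & (inZp x : G) \in Q :* c].
have mP c : m c = cnt (P c) 0 u.
  rewrite -card_residues; apply: eq_card => r.
  by rewrite !inE /P inZp_val ltn_ord.
have Pc c : c \in A -> P c c.
  by rewrite inE /P ltn_ord inZp_val rcoset_refl => ->.
have Pu c x : P c x -> (x < u)%N by case/and3P.
rewrite !mP; apply: leq_trans (cnt_sumset_ge (Pc _ c1A) (Pc _ c2A) (@Pu _) (@Pu _)) _.
rewrite ltnS (@cnt_cat _ 0 u) //; last by lia.
rewrite (_ : cnt (sumset _ _) u (u + u) = cnt (fun i => sumset (P c1) (P c2) (u + i)) 0 u); last first.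
  by rewrite cnt_shift addn0.
rewrite /cnt !big_mkord -big_split /=; apply: leq_sum => r _.
have TS t : sumset (P c1) (P c2) t -> S t && ((inZp t : G) \in K).
  case/sumsetP=> x [y [/and3P[_ Xx xc] /and3P[_ Xy yc] <-]].
  apply/andP; split; first by apply/sumsetP; exists x, y.
  rewrite inZpM /K; move: xc yc; rewrite !mem_rcoset => xc yc.
  have := groupM xc yc.
  by rewrite invMg [c2^-1 * _]Zp_commute !mulgA -(mulgA (inZp x)) [c1^-1 * _]Zp_commute !mulgA.
have h1 := TS r; have h2 := TS (u + r); rewrite inZp_val in h1; rewrite inZpD_u in h2.
rewrite /rho; case: (sumset _ _ r) h1 => [/(_ isT)/andP[-> rK]|_].
  by case: (sumset _ _ (u + r)) h2 => [/(_ isT)/andP[-> _]|_]; rewrite rK ?mul1n.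
case: (sumset _ _ (u + r)) h2 => [/(_ isT)/andP[-> ->]|//].
by rewrite mul1n leq_addl.
Qed.

(** The elements [0] and [u] of [X] share a residue, so [n = N + 1] and the negation of the claim is
    [2 N <= u], the sparseness excluded by [lifts_not_sparse]. *)
Lemma freiman_3k4 : u + 3 <= 2 * n.
Proof.
rewrite leqNgt; apply/negP=> lt; apply: (@lifts_not_sparse G Zp_commute A rho).
- exact: residues1.
- exact: residues_generate.
- by move=> r /residues_lifts /andP[rS1 rS2]; rewrite /rho rS1 rS2.
- by move=> r /residues_mul_lift; rewrite /rho; case: (S r); case: (S _).
- exact: residues_coset_lifts.
- rewrite card_ord; move: lt; rewrite cnt_residues -/N -/u; move: N u; clear; lia.
- move: small; rewrite sum_lifts cnt_residues -/N.
  by move: N (\sum_(r : G) rho r)%N; clear=> a b; lia.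
Qed.

End Freiman.

(** * Sum-free sets with many elements in a half-circle *)

(** [H] keeps small multiples of [m] out of the gap from [p - 2k] to [2k] modulo [p]. If [m] is
    shorter than the gap, its first multiple past [p - 2k] falls into it. Otherwise [d = 1, 2] force
    [k <= m <= p - 2k], so [m] is near [p / 3], and the multiples [2 + 3 j] (if [3 m < p]) or
    [1 + 3 j] move by [|p - 3 m|] at a time until they enter the gap. *)
Lemma multiples_hit_gap p k m :
    3 * p + 6 <= 10 * k -> 3 * k <= p + 1 -> 3 * m != p -> 2 <= m -> 2 * m < p ->
  (forall d q, 1 <= d -> d + p + 2 <= 4 * k ->
     ~~ ((q * p + p < m * d + 2 * k) && (m * d < q * p + 2 * k))) -> False.
Proof.
move=> k1 k2 m3 m2 mp H.
have m1 : m <= p - 2 * k by have := H 1 0 isT; lia.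
have [small|big] := leqP (m + p + 1) (4 * k).
  have m0 : 0 < m by lia.
  pose j := (p - 2 * k) %/ m.
  have h1 : j * m <= p - 2 * k by apply: leq_divM.
  have h2 : p - 2 * k < j.+1 * m by apply: ltn_ceil.
  have h3 : 2 * j <= p - 2 * k by nia.
  by have := H j.+1 0 isT; rewrite mulnC; move: h1 h2; rewrite mulSn; lia.
have m4 : k <= m by have := H 2 0 isT; lia.
have [lt3|gt3|eq3] := ltngtP (3 * m) p; last by rewrite eq3 eqxx in m3.
  pose e := p - 3 * m; have e0 : 0 < e by rewrite /e; lia.
  pose j := (2 * m - 2 * k) %/ e.
  have h1 : j * e <= 2 * m - 2 * k by apply: leq_divM.
  have h2 : 2 * m - 2 * k < j.+1 * e by apply: ltn_ceil.
  have h3 : j <= 2 * m - 2 * k by nia.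
  have e1 : m * (2 + 3 * j.+1) + j.+1 * e = 2 * m + j.+1 * p.
    have ep : p = e + 3 * m by rewrite /e; lia.
    by rewrite [X in _ = _ + _ * X]ep; nia.
  have := H (2 + 3 * j.+1) j.+1 isT.
  by move: h1 h2 e1; rewrite !mulSn /e; lia.
pose e := 3 * m - p; have e0 : 0 < e by rewrite /e; lia.
pose j := (p - 2 * k - m) %/ e.
have h1 : j * e <= p - 2 * k - m by apply: leq_divM.
have h2 : p - 2 * k - m < j.+1 * e by apply: ltn_ceil.
have h3 : j <= p - 2 * k - m by nia.
have e1 : m * (1 + 3 * j.+1) = m + j.+1 * e + j.+1 * p.
  have ep : 3 * m = e + p by rewrite /e; lia.
  by rewrite -addnA -mulnDr -ep; nia.
have := H (1 + 3 * j.+1) j.+1 isT.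
by move: h1 h2 e1; rewrite !mulSn /e; lia.
Qed.

Lemma hull (a : pred nat) i w : 0 < cnt a i (i + w) ->
  exists i' u, [/\ u < w, a i', a (i' + u) & cnt a i' (i' + u).+1 = cnt a i (i + w)].
Proof.
move=> pos.
have ex : exists x, (i <= x < i + w) && a x.
  have : has a (index_iota i (i + w)).
    apply: contraTT pos => /hasPn h; rewrite cnt0 // => x hx.
    by apply: h; rewrite mem_index_iota.
  by case/hasP=> x; rewrite mem_index_iota => h ax; exists x; rewrite h.
case: (ex_minnP ex) => l /andP[lw al] lmin.
have ub x : (i <= x < i + w) && a x -> x <= i + w by lia.
case: (ex_maxnP ex ub) => r /andP[rw ar] rmax.
have lr : l <= r by apply: rmax; rewrite lw.
exists l, (r - l); rewrite subnKC // al ar; split=> //; first by lia.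
rewrite (@cnt_cat a i l (i + w)) ?(@cnt_cat a l r.+1 (i + w)); try lia.
have -> : cnt a i l = 0.
  by apply: cnt0 => x hx; apply/negP=> ax; have := lmin x; rewrite ax; lia.
have -> : cnt a r.+1 (i + w) = 0.
  by apply: cnt0 => x hx; apply/negP=> ax; have := rmax x; rewrite ax; lia.
by rewrite addn0.
Qed.

Lemma cnt_multiples (X : pred nat) d v : 0 < d -> (forall x, X x -> d %| x) ->
  cnt (fun x => X (d * x)) 0 v.+1 = cnt X 0 (d * v).+1.
Proof.
move=> d0 dX; elim: v => [|v IH]; first by rewrite muln0 !cnt1 muln0.
rewrite (@cnt_cat _ 0 v.+1) // IH cnt1.
rewrite (@cnt_cat X 0 (d * v).+1 (d * v.+1).+1) //; last by rewrite mulnS; lia.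
rewrite (@cnt_cat X (d * v).+1 (d * v.+1)) //; last by rewrite mulnS; lia.
rewrite cnt1 [cnt X (d * v).+1 _]cnt0 ?add0n // => x hx; apply/negP=> /dX /dvdnP[q eq].
by move: hx; rewrite eq [q * d]mulnC !ltn_pmul2l; lia.
Qed.

Section Residues.
Variables (p m k : nat).
Hypothesis p_pr : prime p.

(** Subsets of [Z/p] are encoded as [p]-periodic predicates on [nat], so that windows may run past
    [p] and dilations need no reduction. *)
Definition periodic (a : pred nat) := forall x, a (x + p) = a x.
Definition sum_free (a : pred nat) :=
  forall x y z, a x -> a y -> a z -> (x + y) %% p != (m * z) %% p.

Lemma periodicM a x c : periodic a -> a (x + c * p) = a x.
Proof.
by move=> pa; elim: c => [|c IH]; rewrite ?addn0 // mulSnr addnA pa IH.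
Qed.

Lemma periodic_mod a x : periodic a -> a (x %% p) = a x.
Proof. by move=> pa; rewrite {2}(divn_eq x p) addnC periodicM. Qed.

Lemma periodic_eq a x y : periodic a -> x = y %[mod p] -> a x = a y.
Proof. by move=> pa e; rewrite -periodic_mod // e periodic_mod. Qed.

Lemma cnt_period a i : periodic a -> cnt a i (i + p) = cnt a 0 p.
Proof.
move=> pa; elim: i => // i <-; apply/eqP; rewrite -(eqn_add2l (a i)).
rewrite -[X in X + _ == _](cnt1 a) -cnt_cat //; last by rewrite addSn ltnS leq_addr.
by rewrite addSn (@cnt_cat a i (i + p)) ?leq_addr // cnt1 pa addnC.
Qed.

Lemma periodic_dilate a d : periodic a -> periodic (fun x => a (d * x)).
Proof. by move=> pa x; rewrite mulnDr (periodicM _ _ pa). Qed.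

Lemma dilate_inj d (p0 : 0 < p) : coprime d p ->
  injective (fun x : 'I_p => Ordinal (ltn_pmod (d * x) p0)).
Proof.
move=> dp x y /(congr1 val) /= /eqP; wlog le : x y / y <= x.
  move=> W; have [|/ltnW] := leqP y x; first exact: W.
  by move=> le; rewrite eq_sym => /(W _ _ le).
rewrite eqn_mod_dvd ?leq_mul2l ?le ?orbT // -mulnBr.
rewrite Gauss_dvdr 1?coprime_sym // -eqn_mod_dvd //.
by rewrite !modn_small // => /eqP /val_inj.
Qed.

Lemma cnt_dilate a d : periodic a -> coprime d p ->
  cnt (fun x => a (d * x)) 0 p = cnt a 0 p.
Proof.
move=> pa dp; rewrite /cnt !big_mkord.
rewrite [RHS](reindex_inj (@dilate_inj d (prime_gt0 p_pr) dp)) /=.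
by apply: eq_bigr => x _; rewrite periodic_mod.
Qed.

Lemma inverse_mod d : 0 < d < p -> exists d', d' * d = 1 %[mod p] /\ coprime d' p.
Proof.
move=> dp; have cd : coprime d p.
  by rewrite coprime_sym prime_coprime //; apply/negP=> /dvdn_leq; lia.
have d0 : 0 < d by lia.
case: (egcdnP p d0) => km kn; rewrite (eqP cd) => e _.
have ed : km * d = 1 %[mod p] by rewrite e modnMDl.
exists km; split=> //.
have : coprime (km * d) p by rewrite -coprime_modl ed coprime_modl coprime1n.
by rewrite coprimeMl => /andP[].
Qed.

(** [b] is the dilate [m A], expressed through the inverse [m'] of [m]. *)
Lemma dual_pred a : 0 < m < p -> periodic a -> sum_free a ->
  exists b, [/\ periodic b, cnt b 0 p = cnt a 0 p,
    forall x y, a x -> a y -> ~~ b (x + y) & forall x, a x -> b (m * x)].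
Proof.
move=> /inverse_mod[m' [m'm cm']] pa sf; exists (fun y => a (m' * y)).
split; [exact: periodic_dilate | exact: cnt_dilate | |].
  move=> x y ax ay; apply/negP=> /(sf _ _ _ ax ay).
  by rewrite mulnA [m * m']mulnC -modnMml m'm modnMml mul1n eqxx.
by move=> x ax; rewrite (@periodic_eq _ _ x) // mulnA -modnMml m'm modnMml mul1n.
Qed.

Lemma avoid_card (S c : pred nat) q N : periodic c -> N <= p ->
  (forall t, S t -> ~~ c (q + t)) -> cnt S 0 N + cnt c 0 p <= p.
Proof.
move=> pc Np h; rewrite -(cnt_period q pc) -{1}[q]addn0 -cnt_shift.
apply: leq_trans (leq_add (sub_cnt S (leqnn 0) Np) (leqnn _)) _.
rewrite -[leqRHS]subn0; apply: sum_bool_le => t _.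
by apply/negP=> /andP[/h /negP].
Qed.

Lemma avoid_window (c : pred nat) q st l : periodic c -> l <= p ->
    (forall t, st <= t < st + l -> ~~ c (q + t)) ->
  cnt c (q + st + l) (q + st + l + (p - l)) = cnt c 0 p.
Proof.
move=> pc lp h; rewrite -(cnt_period (q + st) pc).
rewrite [RHS](@cnt_cat _ _ (q + st + l)) ?leq_addr //; last by lia.
rewrite [X in _ = X + _]cnt0 ?add0n; first by congr cnt; lia.
move=> t ht; have := h (t - q); rewrite subnKC; last by lia.
by apply; lia.
Qed.

(** * Consequences of a dense window, with [b] in the role of the dilate of [a] *)

Section Windows.
Variables (a b : pred nat) (i u : nat).
Hypotheses (pa : periodic a) (pb : periodic b).
Hypothesis ab : forall x y, a x -> a y -> ~~ b (x + y).
Hypotheses (ka : cnt a 0 p = k) (kb : cnt b 0 p = k).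
Hypotheses (ai : a i) (aiu : a (i + u)) (up : 2 * u < p).
Let n := cnt a i (i + u).+1.
Let X : pred nat := fun x => (x <= u) && a (i + x).

Lemma window_cnt : cnt X 0 u.+1 = n.
Proof.
rewrite /n -addnS -{1}[i]addn0 -cnt_shift; apply: eq_cnt => x.
by rewrite /X ltnS /= => ->.
Qed.

Lemma window_le : n <= u.+1.
Proof. by rewrite -window_cnt; apply: leq_trans (cnt_le _ _ _) _; rewrite subn0. Qed.

Lemma window_avoid t : sumset X X t -> ~~ b (2 * i + t).
Proof.
case/sumsetP=> x [y [/andP[_ ax] /andP[_ ay] <-]].
by rewrite mul2n -addnn addnACA; apply: ab.
Qed.

Lemma window_sumset : cnt (sumset X X) 0 (u + u).+1 + k <= p.
Proof. by rewrite -kb; apply: avoid_card window_avoid => //; lia. Qed.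

Hypothesis large : p + 4 <= 3 * n + k.
Hypothesis dense : u + 3 <= 2 * n.

Lemma window_bounded x : X x -> x <= u. Proof. by case/andP. Qed.
Lemma window_first : X 0. Proof. by rewrite /X addn0. Qed.
Lemma window_last : X u. Proof. by rewrite /X leqnn. Qed.

(** [sumset_card] gives [X + X] at least [u + n] elements, and they avoid the [k] residues of
    [b]. *)
Lemma window_hull : u + n + k <= p.
Proof.
have := @sumset_card X X u window_first window_first window_last; rewrite window_cnt.
have := window_sumset; have := dense; rewrite mul2n -addnn => h1 h2 /(_ h1); lia.
Qed.

Lemma dual_window : exists j, cnt b j (j + (p + 1 - 2 * n)) = k.
Proof.
have := @sumset_interval X X u window_bounded window_bounded window_first window_first window_last; rewrite window_cnt.
have := window_sumset; have := dense; have := window_hull; have := window_le.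
rewrite mul2n -addnn => h0 h1 h2 h3 /(_ h2).
case=> [|st hst]; first by lia.
have l : n + n - 1 <= p by lia.
have := @avoid_window b (2 * i) st _ pb l; rewrite kb => h.
exists (2 * i + st + (n + n - 1)).
rewrite (_ : p + 1 - (n + n) = p - (n + n - 1)); last by lia.
by apply: h => t /hst /window_avoid.
Qed.

Hypotheses (nk : n <= k) (k4 : p + 4 <= 4 * k).

(** [X' + Y] is, up to translation, the difference of [b] and the window of [a]. It misses [a], and
    by [large] it does not wrap around modulo [p]; [sumset_interval] finds in it [n + k - 1]
    consecutive elements. *)
Lemma extend_window : exists j, cnt a j (j + (p + 1 - n - k)) = k.
Proof.
have [j0 ej0] := dual_window.
have k0 : 0 < k by lia.
have := @hull b j0 (p + 1 - 2 * n); rewrite ej0 => /(_ k0)[j [v [vp bj bjv ev]]].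
pose X' : pred nat := fun x => (x <= u) && a (i + u - x).
pose Y : pred nat := fun y => (y <= v) && b (j + y).
(* [q] represents [j - (i + u)]: the multiple [c] of [p] avoids truncation. *)
pose c := (i + u) * p; pose q := j + (c - (i + u)).
have p0 := prime_gt0 p_pr.
have S_avoid t : sumset X' Y t -> ~~ a (q + t).
  case/sumsetP=> x [y [/andP[xu ax] /andP[_ bY] <-]]; apply/negP=> aq.
  have := ab aq ax.
  have hc : i + u <= c by rewrite /c leq_pmulr.
  rewrite (_ : q + (x + y) + (i + u - x) = j + y + (i + u) * p) ?periodicM ?bY //.
  by rewrite -/c /q; lia.
have cX : cnt X' 0 u.+1 = n.
  rewrite (@eq_cnt _ (fun x => a (i + u - x))); last by move=> x /=; rewrite /X' ltnS => ->.
  by rewrite /cnt cnt_rev; [rewrite subn0 (_ : _ - _ = i); lia | lia].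
have cY : cnt Y 0 v.+1 = k.
  rewrite -ev -addnS -{1}[j]addn0 -cnt_shift; apply: eq_cnt => y.
  by rewrite /Y ltnS /= => ->.
have h1 := window_hull; have h2 := window_le.
have X'u x : X' x -> x <= u by case/andP.
have Yv x : Y x -> x <= v by case/andP.
have Scard w : cnt (sumset X' Y) 0 w + k <= p.
  have [wl|lw] := leqP w (u + v).+1.
    by rewrite -ka; apply: avoid_card S_avoid => //; lia.
  rewrite (@cnt_cat _ 0 (u + v).+1) ?(ltnW lw) // [cnt _ (u + v).+1 _]cnt0 ?addn0; last first.
    by move=> t ht; apply/negP=> /sumsetP[x [y [/X'u + /Yv]]]; lia.
  by rewrite -ka; apply: avoid_card S_avoid => //; lia.
have [st hst] : exists st, forall t, st <= t < st + (n + k - 1) -> sumset X' Y t.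
  (* In [sumset_interval] the second set must attain the common bound, so the set with the longer
     window goes second. *)
  have [uv|vu] := leqP u v.
    have := @sumset_interval X' Y v _ Yv; rewrite cY.
    rewrite (@cnt_cat X' 0 u.+1 v.+1 (leq0n _) uv) cX [cnt X' u.+1 _]cnt0 ?addn0; last first.
      by move=> x hx; apply/negP=> /X'u; lia.
    apply=> //; first by move=> x /X'u; lia.
    - by rewrite /X' subn0 aiu.
    - by rewrite /Y addn0 bj.
    - by rewrite /Y leqnn bjv.
    - by lia.
    - by have := Scard (v + v).+1; lia.
  have := @sumset_interval Y X' u _ X'u; rewrite cX.
  rewrite (@cnt_cat Y 0 v.+1 u.+1 (leq0n _) (ltnW vu)) cY [cnt Y v.+1 _]cnt0 ?addn0; last first.
    by move=> x hx; apply/negP=> /Yv; lia.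
  case=> //; first by move=> x /Yv; lia.
  - by rewrite /Y addn0 bj.
  - by rewrite /X' subn0 aiu.
  - by rewrite /X' leqnn addnK.
  - by lia.
  - have := Scard (u + u).+1; rewrite (@eq_cnt (sumset Y X') (sumset X' Y)); first by lia.
    by move=> t _; apply: sumsetC.
  by move=> st hst; exists st => t ht; rewrite sumsetC; apply: hst; lia.
have l : n + k - 1 <= p by lia.
have := @avoid_window a q st _ pa l; rewrite ka => h.
exists (q + st + (n + k - 1)).
rewrite (_ : p + 1 - n - k = p - (n + k - 1)); last by lia.
by apply: h => t /hst /S_avoid.
Qed.

End Windows.

Hypotheses (m2 : 2 <= m) (mp : m + 2 <= p).
Hypotheses (k1 : 3 * p + 6 <= 10 * k) (k3 : 3 * k <= p + 1).

(** A small [d] is a difference of two elements of [a], so [m d] is a difference of two elements of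
    [b] and lies within [p - 2k] of a multiple of [p]; [multiples_hit_gap] forbids this. *)
Lemma two_windows a b i j : periodic a -> periodic b ->
    cnt a 0 p = k -> (forall x, a x -> b (m * x)) ->
    cnt a i (i + (p + 1 - 2 * k)) = k -> cnt b 0 p = k ->
    cnt b j (j + (p + 1 - 2 * k)) = k -> False.
Proof.
move=> pa pb ka abm wa kb wb.
pose L := p + 1 - 2 * k; rewrite -/L in wa wb.
have bwin x : b x -> exists r, r < L /\ x = j + r %[mod p].
  move=> bx; have := cnt_period j pb; rewrite kb.
  rewrite (@cnt_cat b j (j + L)) ?leq_addr //; last by rewrite /L; lia.
  rewrite wb => e0.
  have p0 := prime_gt0 p_pr.
  pose c := j * p; have jc : j <= c by rewrite /c leq_pmulr.
  pose r := (x + (c - j)) %% p.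
  have ex : x = j + r %[mod p].
    rewrite modnDmr (_ : j + (x + (c - j)) = c + x); last by lia.
    by rewrite modnMDl.
  have bjr : b (j + r) by rewrite -(periodic_eq pb ex).
  exists r; split=> //; rewrite ltnNge; apply/negP=> Lr.
  have rp : r < p by apply: ltn_pmod.
  have := @sub_cnt b (j + r) (j + r).+1 (j + L) (j + p).
  by rewrite cnt1 bjr; lia.
have key d : 1 <= d -> d + p + 2 <= 4 * k -> exists r1 r2,
    [/\ r1 < L, r2 < L & r1 + m * d = r2 %[mod p]].
  move=> d1 dk.
  (* Otherwise [a] and [a - d] would be disjoint in the window while filling at least [k] and
     [k - d] of its [L] places. *)
  have [x [ax axd]] : exists x, a x /\ a (x + d).
    have := @sum_bool_le a (fun x => a (d + x)) i (i + L).
    have [/existsP[x /andP[ax axd]] _|] := boolP [exists x : 'I_(i + L), a x && a (d + x)].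
      by exists x; split=> //; rewrite [x + d]addnC.
    rewrite negb_exists => /forallP h.
    have h' x : i <= x < i + L -> ~~ (a x && a (d + x)).
      by move=> /andP[_ hx]; have := h (Ordinal hx).
    move=> /(_ h'); rewrite -/(cnt a i (i + L)) -/(cnt (fun x => a (d + x)) i (i + L)).
    rewrite cnt_shift wa.
    have : k <= cnt a (d + i) (d + (i + L)) + d.
      have c1 := @cnt_cat a i (d + i) (d + (i + L)) (leq_addl _ _).
      have c2 := @sub_cnt a i (i + L) i (d + (i + L)) (leqnn _) (leq_addl _ _).
      have := c1 _; rewrite leq_add2l leq_addr => /(_ isT) c3.
      by have := cnt_le a i (d + i); rewrite wa in c2; lia.
    by rewrite /L; lia.
  have [r1 [r1L e1]] := bwin _ (abm _ ax).
  have [r2 [r2L e2]] := bwin _ (abm _ axd).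
  exists r1, r2; split=> //.
  have : j + (r1 + m * d) = j + r2 %[mod p].
    by rewrite -e2 addnA -modnDml -e1 modnDml mulnDr.
  by move/eqP; rewrite eqn_modDl => /eqP.
have not_dvd d : 1 < d < 4 -> ~~ (d %| p).
  move=> hd; have [_ h] := primeP p_pr; apply/negP=> /h; lia.
have not3 mm : 3 * mm != p.
  by apply: contraTneq (not_dvd 3 isT) => <-; rewrite dvdn_mulr.
have [lt|gt|e2] := ltngtP (2 * m) p.
- apply: (multiples_hit_gap k1 k3 (not3 _) m2 lt) => d q d1 dk.
  apply/negP=> /andP[h1 h2]; have [r1 [r2 [r1L r2L]]] := key d d1 dk.
  have -> : r1 + m * d = q * p + (r1 + (m * d - q * p)) by lia.
  rewrite /L in r1L r2L; rewrite modnMDl (modn_small (m := r1 + _)) ?(modn_small (m := r2)); lia.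
(* The condition on distances is symmetric under negation, so [m] may be replaced by [p - m]. *)
- have mm2 : 2 <= p - m by lia.
  have mmp : 2 * (p - m) < p by lia.
  apply: (multiples_hit_gap k1 k3 (not3 _) mm2 mmp) => d q d1 dk.
  apply/negP=> /andP[h1 h2]; have [r1 [r2 [r1L r2L]]] := key d d1 dk.
  move/eqP; rewrite -(eqn_modDr ((p - m) * d)).
  have -> : r1 + m * d + (p - m) * d = d * p + r1.
    by rewrite -addnA -mulnDl subnKC ?[p * d]mulnC 1?addnC //; lia.
  have -> : r2 + (p - m) * d = q * p + (r2 + ((p - m) * d - q * p)) by lia.
  rewrite /L in r1L r2L; rewrite !modnMDl (modn_small (m := r1)) ?(modn_small (m := r2 + _)); lia.
- by have := not_dvd 2 isT; rewrite -e2 dvdn_mulr.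
Qed.

(** The induction on [u] serves only to remove a common divisor of the window, which [freiman_3k4]
    does not allow. *)
Lemma no_dense_window a i u : periodic a -> sum_free a -> cnt a 0 p = k ->
    2 * u < p -> a i -> a (i + u) -> p + 4 <= 3 * cnt a i (i + u).+1 + k -> False.
Proof.
have [N uN] := ubnP u; elim: N => // N IH in a i u uN *.
move=> pa sf ka up ai aiu large.
have mpos : 0 < m < p by lia.
have [b [pb kb ab abm]] := dual_pred mpos pa sf; rewrite ka in kb.
have nk : cnt a i (i + u).+1 <= k.
  rewrite -ka -(cnt_period i pa); apply: sub_cnt => //; lia.
have k4 : p + 4 <= 4 * k by lia.
pose X x := (x <= u) && a (i + x).
have hn := window_cnt a i u; have hnu := window_le a i u.
have u0 : 0 < u by lia.
(* If the window lies in multiples of [d], dilating by the inverse of [d] gives a window of length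
   [u / d] with the same count. *)
have [/existsP[[d du] /andP[/= d1 /forallP /= dX]]|nd] :=
    boolP [exists d : 'I_u.+1, (1 < d) && [forall x : 'I_u.+1, X x ==> (d %| x)]].
  have dX' x : X x -> d %| x.
    move=> Xx; have xu : x < u.+1 by case/andP: Xx.
    by have := dX (Ordinal xu); rewrite /= Xx.
  have /dvdnP[v ev] : d %| u by apply: dX'; rewrite /X leqnn.
  have dp : 0 < d < p by lia.
  have cdp : coprime d p by rewrite coprime_sym prime_coprime // gtnNdvd; lia.
  have [d' [ed' _]] := inverse_mod dp.
  have ei : d * (d' * i) = i %[mod p].
    by rewrite mulnA [d * d']mulnC -modnMml ed' modnMml mul1n.
  have axi x : a (d * (d' * i + x)) = a (i + d * x).
    by apply: periodic_eq => //; rewrite mulnDr -modnDml ei modnDml.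
  have vu : v < u by rewrite ev -{1}[v]muln1 ltn_pmul2l //; case: (v) ev => //; lia.
  apply: (IH (fun x => a (d * x)) (d' * i) v); first by lia.
  - exact: periodic_dilate.
  - move=> x y z ax ay az; apply: contraTneq isT => e.
    have := sf _ _ _ ax ay az; rewrite -mulnDr [m * _]mulnCA.
    by rewrite -modnMmr e modnMmr eqxx.
  - by rewrite cnt_dilate.
  - by lia.
  - by rewrite -[d' * i]addn0 axi muln0 addn0.
  - by rewrite axi [d * v]mulnC -ev.
  rewrite -addnS -{1}[d' * i]addn0 -cnt_shift.
  rewrite (_ : cnt _ 0 v.+1 = cnt a i (i + u).+1) // -window_cnt.
  have d0 : 0 < d by lia.
  have -> : u.+1 = (d * v).+1 by rewrite mulnC -ev.
  rewrite -(cnt_multiples v d0) //; apply: eq_cnt => x xv.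
  by rewrite axi ev [v * d]mulnC leq_pmul2l //; have -> : x <= v by lia.
have prim d : 1 < d -> exists2 x, X x & ~~ (d %| x).
  move=> d1; have [ud|du] := ltnP u d.
    by exists u; rewrite ?gtnNdvd // /X leqnn.
  move: nd; rewrite negb_exists => /forallP /(_ (Ordinal (du : d < u.+1))).
  by rewrite /= d1 /= negb_forall => /existsP[x]; rewrite negb_imply => /andP[]; exists x.
have dense : u + 3 <= 2 * cnt a i (i + u).+1.
  have XS := window_sumset pb ab ka kb ai aiu up.
  have := @freiman_3k4 u.-1 X; rewrite prednK // hn; apply=> //.
  - by move=> x /andP[].
  - by rewrite /X addn0.
  - by rewrite /X leqnn.
  - by move: XS; rewrite -/X; lia.
(* From here the window contains all of [a]: the window lemmas are applied again with [n = k]. *)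
have [j ej] := extend_window pa pb ab ka kb ai aiu up large dense nk k4.
have k0 : 0 < k by lia.
have := @hull a j (p + 1 - cnt a i (i + u).+1 - k).
rewrite ej => /(_ k0)[i2 [u2 [u2l ai2 aiu2 e2]]].
have up2 : 2 * u2 < p by lia.
have large2 : p + 4 <= 3 * cnt a i2 (i2 + u2).+1 + k by rewrite e2; lia.
have dense2 : u2 + 3 <= 2 * cnt a i2 (i2 + u2).+1 by rewrite e2; lia.
have := window_hull pb ab ka kb ai2 aiu2 up2 large2 dense2.
have [j2] := dual_window pb ab ka kb ai2 aiu2 up2 large2 dense2.
rewrite e2 => wb hu; apply: (@two_windows a b i2 j2) => //.
have c1 := cnt_period i2 pa.
have c2 : cnt a i2 (i2 + u2).+1 <= cnt a i2 (i2 + (p + 1 - 2 * k)).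
  by apply: sub_cnt; lia.
have c3 : cnt a i2 (i2 + (p + 1 - 2 * k)) <= cnt a i2 (i2 + p).
  by apply: sub_cnt; lia.
by lia.
Qed.

End Residues.

(** * Sumsets in groups of prime order *)

Section CauchyDavenport.
Local Open Scope group_scope.

(** After translating [A] to contain [1], Mann's theorem would give a subgroup that is trivial or
    everything, and neither fits its conclusion. *)
Lemma prime_sumset_card (gT : finGroupType) (A : {set gT}) :
    (forall x y : gT, x * y = y * x) -> prime #|gT| -> A != set0 ->
    A * A != [set: gT] -> (2 * #|A| <= #|(A * A)%g| + 1)%N.
Proof.
move=> cG p_pr /set0Pn[x xA] AT; rewrite leqNgt; apply/negP=> lt.
pose A0 := A :* x^-1.
have A1 : 1 \in A0 by rewrite mem_rcoset invgK mul1g.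
have A0A0 : A0 * A0 = (A * A) :* (x^-1 * x^-1).
  by rewrite /A0 -mulgA (mulgA [set _] A) (mulg_setC cG [set _] A) -!mulgA mulg_set1.
have [|||Q [_ QT hQ]] := @mann _ cG 1%G A0 A0 A1 (mul1g _) (mul1g _).
- by apply/set0Pn; exists 1.
- apply: contraNneq AT => e; rewrite eqEcard subsetT /=.
  by rewrite -e A0A0 card_rcoset.
- by rewrite A0A0 !card_rcoset cards1; move: lt; card_lia.
rewrite cards1 /A0 card_rcoset in hQ.
have [_ pP] := primeP p_pr.
have := pP #|Q|; rewrite -cardsT cardSg ?subsetT // => /(_ isT) /orP[/eqP Q1|/eqP QG].
  have QE : Q = 1 :> {set gT} by apply/eqP; rewrite eq_sym eqEcard sub1G Q1 cards1.
  by move: hQ; rewrite QE mul1g card_rcoset cards1; card_lia.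
have QE : Q = [set: gT] :> {set gT} by apply/eqP; rewrite eqEcard subsetT QG leqnn.
move/negP: QT; apply; rewrite eqEsubset subsetT -{1}QE.
by apply/subsetP=> q qQ; apply/mulsgP; exists q 1; rewrite ?mulg1.
Qed.

End CauchyDavenport.

(** [A + A] has at least [2k - 1] elements and misses the [k] elements of the dilate [m A]. *)
Lemma sum_free_card p m a : prime p -> 0 < m < p -> periodic p a ->
  sum_free p m a -> 3 * cnt a 0 p <= p + 1.
Proof.
move=> p_pr mp pa sf; have [b [pb kb ab _]] := dual_pred p_pr mp pa sf.
case: p p_pr mp pa sf pb kb ab => // q p_pr mp pa sf pb kb ab.
rewrite -card_residues.
pose A := [set r : 'I_q.+1 | a r]; pose B := [set r : 'I_q.+1 | b r].
rewrite -/A; have cB : #|B| = #|A| by rewrite !card_residues.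
have [->|A0] := eqVneq A set0; first by rewrite cards0.
have sAA : (A * A)%g \subset ~: B.
  apply/subsetP=> r /mulsgP[x y]; rewrite !inE => ax ay ->.
  by rewrite /= (periodic_mod (x + y) pb) ab.
have h1 := subset_leq_card sAA; have h2 := cardsC B; rewrite card_ord in h2.
have := @prime_sumset_card _ A (@Zp_commute q) _ A0; rewrite card_ord => /(_ p_pr) h3.
have : (2 * #|A| <= #|(A * A)%g| + 1)%N.
  apply: h3; apply: contraNneq A0 => e; rewrite -cards_eq0.
  by move: h1 h2; rewrite e cardsT card_ord -cB; card_lia.
by move: h1 h2; rewrite cB; card_lia.
Qed.

Lemma sum_free_dilate p m a d : prime p -> coprime d p ->
  sum_free p m a -> sum_free p m (fun x => a (d * x)).
Proof.
move=> p_pr dp sf x y z ax ay az; have := sf _ _ _ ax ay az; apply: contraNneq => e.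
by rewrite -mulnDr [m * _]mulnCA -modnMmr e modnMmr.
Qed.

(** Every dilate of [a] is again sum-free, and the hull of its part in a half-circle of
    [(p + 1) / 2] points satisfies [2 u < p], as [no_dense_window] requires. *)
Lemma sum_free_half_window p m a d i : prime p -> 2 <= m -> m + 2 <= p ->
    periodic p a -> sum_free p m a -> 3 * p + 6 <= 10 * cnt a 0 p ->
    coprime d p ->
  3 * cnt (fun x => a (d * x)) i (i + p.+1 %/ 2) + cnt a 0 p <= p + 3.
Proof.
move=> p_pr m2 mp pa sf k1 dp.
have m0 : 0 < m < p by lia.
have k3 := sum_free_card p_pr m0 pa sf.
have pd := periodic_dilate d pa; have kd := cnt_dilate p_pr pa dp.
have sd := sum_free_dilate p_pr dp sf.
rewrite leqNgt; apply/negP=> lt.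
have pos : 0 < cnt (fun x => a (d * x)) i (i + p.+1 %/ 2) by lia.
have [i' [u [uw ai aiu e]]] := hull pos.
have up : 2 * u < p by lia.
apply: (no_dense_window p_pr m2 mp k1 k3 pd sd kd up ai aiu).
by rewrite e; lia.
Qed.

Open Scope R_scope.

(** * Fourier coefficients of sum-free sets *)

Lemma RplusA : associative Rplus. Proof. by move=> x y z; rewrite Rplus_assoc. Qed.
HB.instance Definition _ := Monoid.isComLaw.Build R 0 Rplus RplusA Rplus_comm Rplus_0_l.

Definition rsum (n : nat) (f : nat -> R) : R := \big[Rplus/0]_(i < n) f i.

Lemma rsum0 f : rsum 0 f = 0. Proof. exact: big_ord0. Qed.

Lemma rsumS n f : rsum n.+1 f = rsum n f + f n.
Proof. by rewrite /rsum big_ord_recr. Qed.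

Lemma eq_rsum n f g : (forall i, (i < n)%N -> f i = g i) -> rsum n f = rsum n g.
Proof. by move=> h; apply: eq_bigr => i _; apply: h. Qed.

Lemma rsum_plus n f g : rsum n (fun i => f i + g i) = rsum n f + rsum n g.
Proof. exact: big_split. Qed.

Lemma rsum_scal n c f : rsum n (fun i => c * f i) = c * rsum n f.
Proof. by elim: n => [|n IH]; rewrite ?rsum0 ?rsumS ?IH; ring. Qed.

Lemma rsum_minus n f g : rsum n (fun i => f i - g i) = rsum n f - rsum n g.
Proof. by elim: n => [|n IH]; rewrite ?rsum0 ?rsumS ?IH; ring. Qed.

Lemma rsum_swap n q (f : nat -> nat -> R) :
  rsum n (fun i => rsum q (f i)) = rsum q (fun j => rsum n (fun i => f i j)).
Proof. exact: exchange_big. Qed.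

Lemma rsum_le n f g : (forall i, (i < n)%N -> f i <= g i) -> rsum n f <= rsum n g.
Proof.
elim: n => [|n IH] h; first by rewrite !rsum0; lra.
by rewrite !rsumS; apply: Rplus_le_compat; [apply: IH => i hi; apply: h; lia | apply: h].
Qed.

Lemma rsum_const n c : rsum n (fun=> c) = INR n * c.
Proof. by elim: n => [|n IH]; rewrite ?rsum0 ?rsumS ?IH ?S_INR /=; ring. Qed.

Lemma rsum_add n q f : rsum (n + q) f = rsum n f + rsum q (fun i => f (n + i)%N).
Proof.
elim: q => [|q IH]; first by rewrite addn0 rsum0; ring.
by rewrite addnS !rsumS IH; ring.
Qed.

Lemma rsum_recl n f : rsum n.+1 f = f 0%N + rsum n (fun i => f i.+1).
Proof. by rewrite -add1n rsum_add rsumS rsum0; ring_simplify. Qed.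

Lemma rsum_rev n f : rsum n (fun i => f (n - i)%N) = rsum n (fun i => f i.+1).
Proof.
elim: n f => [|n IH] f; first by rewrite !rsum0.
by rewrite rsumS rsum_recl subSnn -(IH (fun i => f i.+1)) Rplus_comm; congr (_ + _);
  apply: eq_rsum => i hi; rewrite subSn // ltnW.
Qed.

Lemma rsum_shift p f c : (forall x, f (x + p)%N = f x) ->
  rsum p (fun i => f (c + i)%N) = rsum p f.
Proof.
move=> pf; elim: c => [|c IH]; first exact: eq_rsum.
rewrite -{}IH; have := rsum_recl p (fun i => f (c + i)%N).
rewrite rsumS pf addn0 (@eq_rsum _ (fun i => f (c + i.+1)%N) (fun i => f (c.+1 + i)%N)); first lra.
by move=> i _; rewrite addSnnS.
Qed.

Lemma rsum_dilate p d f : prime p -> coprime d p -> (forall x, f (x + p)%N = f x) ->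
  rsum p (fun i => f (d * i)%N) = rsum p f.
Proof.
move=> p_pr dp pf; have p0 := prime_gt0 p_pr.
have fM x c : f (x + c * p)%N = f x.
  by elim: c => [|c IH]; rewrite ?addn0 // mulSnr addnA pf IH.
pose h (x : 'I_p) := Ordinal (ltn_pmod (d * x) p0).
have hi : injective h by apply: dilate_inj dp.
rewrite /rsum [RHS](reindex_inj hi) /=; apply: eq_bigr => x _.
by rewrite {1}(divn_eq (d * x) p) addnC fM.
Qed.

Lemma rsum_cnt p (a : pred nat) : rsum p (fun x => INR (a x)) = INR (cnt a 0 p).
Proof.
elim: p => [|p IH]; first by rewrite rsum0 /cnt big_geq.
by rewrite rsumS IH (@cnt_cat a 0 p p.+1) // cnt1 plus_INR.
Qed.

Lemma rsum3 n f g h :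
  rsum n (fun x => rsum n (fun y => rsum n (fun z => f x * g y * h z))) =
  rsum n f * rsum n g * rsum n h.
Proof.
rewrite (@eq_rsum _ _ (fun x => (rsum n g * rsum n h) * f x)); first by rewrite rsum_scal; ring.
move=> x _; rewrite (@eq_rsum _ _ (fun y => (f x * rsum n h) * g y)); first by rewrite rsum_scal; ring.
by move=> y _; rewrite rsum_scal; ring.
Qed.

Lemma rsum2 n f g : rsum n (fun x => rsum n (fun y => f x * g y)) = rsum n f * rsum n g.
Proof.
rewrite (@eq_rsum _ _ (fun x => rsum n g * f x)); first by rewrite rsum_scal; ring.
by move=> x _; rewrite rsum_scal; ring.
Qed.

Lemma INR_gt0 n : (0 < n)%N -> 0 < INR n.
Proof. by move=> n0; apply: lt_0_INR; lia. Qed.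

Section Fourier.
Variables (p : nat) (a : pred nat).
Hypothesis p_pr : prime p.
Let P := INR p.
Let w := 2 * PI / P.
Let A x := INR (a x).
Let k := cnt a 0 p.

Definition cosine (r : nat) := rsum p (fun x => A x * cos (w * INR r * INR x)).
Definition sine (r : nat) := rsum p (fun x => A x * sin (w * INR r * INR x)).

Lemma sin_multiple_neq0 s : (0 < s < p)%N -> sin (PI * INR s / P) <> 0.
Proof.
move=> /andP[s0 sp]; have P0 : 0 < P := INR_gt0 (prime_gt0 p_pr); have := PI_RGT_0 => pi0.
have h1 : 0 < INR s by apply: lt_0_INR; lia.
have h2 : INR s < P by apply: lt_INR; lia.
apply: Rgt_not_eq; apply: sin_gt_0.
  by apply: Rdiv_lt_0_compat => //; nra.
by apply: (Rmult_lt_reg_r P) => //; rewrite /Rdiv Rmult_assoc Rinv_l; nra.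
Qed.

Lemma frequency_period r c : w * INR r * (INR c * P) = 2 * INR (r * c) * PI.
Proof. by rewrite mult_INR /w; field; apply: Rgt_not_eq (INR_gt0 (prime_gt0 p_pr)). Qed.

(** Multiplication by [2 sin (PI s / p)], which is nonzero, makes the sum telescope over a full
    period. *)
Lemma orthogonality t : ~~ (p %| t)%N -> rsum p (fun r => cos (w * INR r * INR t)) = 0.
Proof.
move=> pt; pose s := (t %% p)%N.
have s0 : (0 < s < p)%N by rewrite lt0n -/(dvdn p t) pt /s ltn_pmod ?prime_gt0.
have -> : rsum p (fun r => cos (w * INR r * INR t)) = rsum p (fun r => cos (w * INR r * INR s)).
  apply: eq_rsum => r _; rewrite {1}(divn_eq t p) plus_INR mult_INR -/s -/P.
  by rewrite Rmult_plus_distr_l frequency_period Rplus_comm cos_period.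
have tel n : 2 * sin (PI * INR s / P) * rsum n (fun r => cos (w * INR r * INR s)) =
    sin (w * (INR n - / 2) * INR s) + sin (PI * INR s / P).
  elim: n => [|n IH].
    rewrite rsum0 /= (_ : w * (0 - / 2) * INR s = - (PI * INR s / P)); first by rewrite sin_neg; ring.
    by rewrite /w; field; apply: Rgt_not_eq (INR_gt0 (prime_gt0 p_pr)).
  rewrite rsumS Rmult_plus_distr_l IH S_INR.
  set c := PI * INR s / P; set e := w * INR n * INR s.
  have -> : w * (INR n - / 2) * INR s = e - c.
    by rewrite /e /c /w; field; apply: Rgt_not_eq (INR_gt0 (prime_gt0 p_pr)).
  have -> : w * (INR n + 1 - / 2) * INR s = e + c.
    by rewrite /e /c /w; field; apply: Rgt_not_eq (INR_gt0 (prime_gt0 p_pr)).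
  by rewrite sin_minus sin_plus; ring.
have := tel p.
have -> : w * (INR p - / 2) * INR s = - (PI * INR s / P) + 2 * INR s * PI.
  by rewrite /w -/P; field; apply: Rgt_not_eq (INR_gt0 (prime_gt0 p_pr)).
rewrite sin_period sin_neg; have := sin_multiple_neq0 s0 => h e.
have {}e : sin (PI * INR s / P) * rsum p (fun r => cos (w * INR r * INR s)) = 0 by lra.
by case: (Rmult_integral _ _ e).
Qed.

Lemma indicator_sq x : A x * A x = A x.
Proof. by rewrite /A; case: (a x) => /=; ring. Qed.

Lemma parseval : rsum p (fun r => cosine r ^ 2 + sine r ^ 2) = P * INR k.
Proof.
have -> : rsum p (fun r => cosine r ^ 2 + sine r ^ 2) =
    rsum p (fun r => rsum p (fun x => rsum p (fun y =>
      A x * A y * cos (w * INR r * (INR x - INR y))))).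
  apply: eq_rsum => r _; rewrite /= !Rmult_1_r -!rsum2 -rsum_plus.
  apply: eq_rsum => x _; rewrite -rsum_plus; apply: eq_rsum => y _.
  by rewrite Rmult_minus_distr_l cos_minus; ring.
rewrite rsum_swap -rsum_cnt -rsum_scal; apply: eq_rsum => x xp.
rewrite rsum_swap (@eq_rsum _ _ (fun y => if y == x then P * A x else 0)); last first.
  move=> y yp; rewrite rsum_scal; have [->|ne] := eqVneq y x.
    rewrite (@eq_rsum _ _ (fun=> 1)) ?rsum_const; first by rewrite indicator_sq -/P; ring.
    by move=> r _; rewrite Rminus_diag_eq // Rmult_0_r cos_0.
  rewrite (@eq_rsum _ _ (fun r => cos (w * INR r * INR (x + (p - y))))).
    rewrite orthogonality; first by ring.
    apply/negP=> /dvdnP[q e]; have := prime_gt0 p_pr; case: q e => [|[|q]] e; lia.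
  move=> r _; rewrite plus_INR minus_INR; last by lia.
  rewrite -/P (_ : INR x + (P - INR y) = (INR x - INR y) + 1 * P); last by ring.
  by rewrite Rmult_plus_distr_l -[1]/(INR 1) frequency_period cos_period.
by rewrite /rsum -big_mkcond (big_pred1 (Ordinal xp)).
Qed.

Lemma cosine0 : cosine 0 = INR k.
Proof.
rewrite /k -rsum_cnt; apply: eq_rsum => x _.
by rewrite Rmult_0_r Rmult_0_l cos_0 Rmult_1_r.
Qed.

Lemma sine0 : sine 0 = 0.
Proof.
rewrite /sine (@eq_rsum _ _ (fun=> 0)) ?rsum_const; first by ring.
by move=> x _; rewrite Rmult_0_r Rmult_0_l sin_0 Rmult_0_r.
Qed.

(** [T r] is the real part of [A^(r)^2 conj (A^(m r))]. The sum over [r] counts solutions of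
    [x + y = m z] and vanishes; the term [r = 0] is [k^3], the others are at least [- M |A^(r)|^2],
    and [parseval] evaluates their total. *)
Lemma fourier_bound m M : (0 < m < p)%N -> sum_free p m a -> 0 <= M ->
    (forall r, ~~ (p %| r)%N -> cosine r ^ 2 + sine r ^ 2 <= M ^ 2) ->
  INR k ^ 3 <= M * (P * INR k - INR k ^ 2).
Proof.
move=> mp sf M0 hM.
pose T r := rsum p (fun x => rsum p (fun y => rsum p (fun z =>
    A x * A y * A z * cos (w * INR r * (INR x + INR y - INR m * INR z))))).
have Tsum : rsum p T = 0.
  rewrite /T rsum_swap -[RHS](Rmult_0_r (INR p)) -rsum_const; apply: eq_rsum => x xp.
  rewrite rsum_swap -[RHS](Rmult_0_r (INR p)) -rsum_const; apply: eq_rsum => y yp.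
  rewrite rsum_swap -[RHS](Rmult_0_r (INR p)) -rsum_const; apply: eq_rsum => z zp.
  rewrite rsum_scal /A.
  case ax: (a x); last by rewrite /=; ring.
  case ay: (a y); last by rewrite /=; ring.
  case az: (a z); last by rewrite /=; ring.
  rewrite (@eq_rsum _ _ (fun r => cos (w * INR r * INR (x + y + m * (p - z))))).
    rewrite orthogonality; first by ring.
    apply: contra (sf _ _ _ ax ay az) => h.
    rewrite -(eqn_modDr (m * (p - z))) -mulnDr subnKC ?(ltnW zp) // modnMl.
    by rewrite -/(dvdn p _).
  move=> r _; rewrite !plus_INR mult_INR minus_INR; last by lia.
  rewrite -/P (_ : INR x + INR y + INR m * (P - INR z) =
     (INR x + INR y - INR m * INR z) + INR m * P); last by ring.
  by rewrite Rmult_plus_distr_l frequency_period cos_period.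
have TE r : T r = (cosine r ^ 2 - sine r ^ 2) * cosine (m * r) +
                  2 * cosine r * sine r * sine (m * r).
  pose c r x := A x * cos (w * INR r * INR x); pose s r x := A x * sin (w * INR r * INR x).
  have -> : T r = rsum p (fun x => rsum p (fun y => rsum p (fun z =>
      c r x * c r y * c (m * r)%N z))) - rsum p (fun x => rsum p (fun y => rsum p (fun z =>
      s r x * s r y * c (m * r)%N z))) + rsum p (fun x => rsum p (fun y => rsum p (fun z =>
      c r x * s r y * s (m * r)%N z))) + rsum p (fun x => rsum p (fun y => rsum p (fun z =>
      s r x * c r y * s (m * r)%N z))).
    rewrite -rsum_minus -!rsum_plus; apply: eq_rsum => x _.
    rewrite -rsum_minus -!rsum_plus; apply: eq_rsum => y _.
    rewrite -rsum_minus -!rsum_plus; apply: eq_rsum => z _.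
    rewrite /c /s mult_INR Rmult_minus_distr_l Rmult_plus_distr_l.
    rewrite (_ : w * INR r * (INR m * INR z) = w * (INR m * INR r) * INR z); last by ring.
    by rewrite cos_minus cos_plus sin_plus; ring.
  by rewrite !rsum3 -/(cosine r) -/(sine r) -/(cosine (m * r)) -/(sine (m * r)); ring.
have T0 : T 0%N = INR k ^ 3 by rewrite TE muln0 cosine0 sine0; ring.
have Tge r : (0 < r < p)%N -> - (M * (cosine r ^ 2 + sine r ^ 2)) <= T r.
  move=> rp; rewrite TE.
  have nd : ~~ (p %| m * r)%N.
    by rewrite Euclid_dvdM // negb_or !gtnNdvd //; lia.
  have := hM _ nd; set C := cosine r; set S := sine r.
  set c := cosine (m * r); set s := sine (m * r) => h.
  set N := C ^ 2 + S ^ 2.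
  have N0 : 0 <= N by rewrite /N; nra.
  have NM : 0 <= M * N by apply: Rmult_le_pos.
  apply: Rnot_lt_le => lt.
  set E := (C ^ 2 - S ^ 2) * c + 2 * C * S * s in lt.
  (* The two squares come, up to sign, from the real and imaginary parts of
     [(C + i S)^2 (c - i s)]. *)
  have e1 : E ^ 2 + ((C ^ 2 - S ^ 2) * s - 2 * C * S * c) ^ 2 = N ^ 2 * (c ^ 2 + s ^ 2).
    by rewrite /E /N; ring.
  have e2 : E ^ 2 <= N ^ 2 * M ^ 2.
    apply: Rle_trans (Rmult_le_compat_l _ _ _ (pow2_ge_0 N) h).
    by rewrite -e1; have := pow2_ge_0 ((C ^ 2 - S ^ 2) * s - 2 * C * S * c); lra.
  by nra.
have p0 := prime_gt0 p_pr.
have := Tsum; have := parseval.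
rewrite -(prednK p0) !rsum_recl T0.
have -> : cosine 0 ^ 2 + sine 0 ^ 2 = INR k ^ 2 by rewrite cosine0 sine0; ring.
set U := rsum _ _ => e1; set V := rsum _ _ => e2.
have : - M * U <= V.
  rewrite /U -rsum_scal; apply: rsum_le => i hi.
  by have := @Tge i.+1; rewrite Ropp_mult_distr_l_reverse; apply; lia.
by rewrite (_ : P * INR k - INR k ^ 2 = U); [nra | lra].
Qed.

End Fourier.

(** * Lev's bound on Fourier coefficients *)

Lemma exists_max (n : nat) (f : nat -> R) : (0 < n)%N ->
  exists2 i, (i < n)%N & forall j, (j < n)%N -> f j <= f i.
Proof.
elim: n => // n IH _; case: n IH => [|n] IH.
  by exists 0%N => // -[|j] //; lra.
have [i ilt imax] := IH isT.
have [le|gt] := Rle_lt_dec (f n.+1) (f i).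
  exists i; first by lia.
  by move=> j; rewrite ltnS leq_eqVlt => /orP[/eqP ->|/imax].
exists n.+1 => // j; rewrite ltnS leq_eqVlt => /orP[/eqP ->|/imax]; lra.
Qed.

Lemma rsum_double n f : rsum (2 * n) f = rsum n (fun i => f (2 * i)%N + f (2 * i).+1).
Proof.
elim: n => [|n IH]; first by rewrite muln0 !rsum0.
by rewrite mulnS addnC addn2 !rsumS IH; ring.
Qed.

(** * Sine sums with interval and trapezoidal weights *)

Section TrigSums.
Variables (p : nat).
Hypothesis p0 : (0 < p)%N.
Let P := INR p.
Let s (i : nat) := sin (PI * INR i / P).
Let t := PI / (2 * P).

Lemma sin_sum l q : 2 * sin t * rsum q (fun i => s (l + i)) =
  cos (PI * (INR l - / 2) / P) - cos (PI * (INR l + INR q - / 2) / P).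
Proof.
have P0 : 0 < P := INR_gt0 p0.
elim: q => [|q IH]; first by rewrite rsum0 /= Rplus_0_r; ring.
rewrite rsumS Rmult_plus_distr_l IH S_INR.
have -> : PI * (INR l + INR q - / 2) / P = PI * INR (l + q) / P - t.
  by rewrite plus_INR /t; field; lra.
have -> : PI * (INR l + (INR q + 1) - / 2) / P = PI * INR (l + q) / P + t.
  by rewrite plus_INR /t; field; lra.
by rewrite cos_minus cos_plus /s; ring.
Qed.

Definition trapezoid (L i : nat) := minn L (minn i (p - i)).

(** Raising [L] by one adds the indicator of the interval between [L] and [p - L], whose sine sum
    telescopes by [sin_sum]. *)
Lemma trapezoid_sum L : (2 * L <= p)%N ->
  2 * sin t ^ 2 * rsum p (fun i => INR (trapezoid L i) * s i) = sin (PI * INR L / P).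
Proof.
have P0 : 0 < P := INR_gt0 p0.
elim: L => [|L IH] Lp.
  rewrite (@eq_rsum _ _ (fun=> 0)) ?rsum_const /= => [|i _].
    by rewrite !Rmult_0_r /Rdiv Rmult_0_l sin_0; ring.
  by rewrite /trapezoid min0n /=; ring.
have step : rsum p (fun i => INR (trapezoid L.+1 i) * s i) =
    rsum p (fun i => INR (trapezoid L i) * s i) +
    rsum (p - 2 * L - 1) (fun i => s (L.+1 + i)).
  have -> : rsum (p - 2 * L - 1) (fun i => s (L.+1 + i)) =
      rsum p (fun i => if (L < i < p - L)%N then s i else 0).
    have -> : p = (L.+1 + (p - 2 * L - 1) + L)%N by lia.
    rewrite !rsum_add (@eq_rsum L.+1 _ (fun=> 0)); last first.
      by move=> i hi; rewrite ifF //; lia.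
    rewrite (@eq_rsum L _ (fun=> 0)); last by move=> i hi; rewrite ifF //; lia.
    rewrite !rsum_const; ring_simplify; rewrite (_ : _ - _ - 1 = p - 2 * L - 1)%N; last by lia.
    by apply: eq_rsum => i hi; rewrite ifT //; lia.
  rewrite -rsum_plus; apply: eq_rsum => i hi.
  have -> : trapezoid L.+1 i = (trapezoid L i + (L < i < p - L))%N.
    by rewrite /trapezoid; lia.
  by rewrite plus_INR; case: (_ && _) => /=; ring.
rewrite step Rmult_plus_distr_l IH; last by lia.
rewrite (_ : 2 * sin t ^ 2 * rsum (p - 2 * L - 1) (fun i => s (L.+1 + i)) =
   sin t * (2 * sin t * rsum (p - 2 * L - 1) (fun i => s (L.+1 + i)))); last by ring.
rewrite sin_sum !minus_INR; try lia.
rewrite mult_INR S_INR /= -/P.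
set u := PI * (INR L + / 2) / P.
have -> : PI * (INR L + 1 - / 2) / P = u by rewrite /u; field; lra.
have -> : PI * (INR L + 1 + (P - (1 + 1) * INR L - 1) - / 2) / P = PI - u.
  by rewrite /u; field; lra.
have -> : PI * INR L / P = u - t by rewrite /u /t; field; lra.
have -> : PI * (INR L + 1) / P = u + t by rewrite /u /t; field; lra.
by rewrite cos_minus sin_plus sin_minus cos_PI sin_PI; ring.
Qed.

End TrigSums.

Section Lev.
Variables (p : nat) (a : pred nat) (n : nat).
Hypotheses (p0 : (2 < p)%N) (podd : odd p).
Hypothesis pa : periodic p a.
Let P := INR p.
Let k := cnt a 0 p.
Hypothesis half : forall i, (cnt a i (i + p.+1 %/ 2) <= n)%N.
Hypothesis kn : (k <= 2 * n)%N.
Hypothesis Lp : (2 * (2 * n - k) <= p)%N.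
Let L := (2 * n - k)%N.

(* Half-circles are indexed modulo [2 p], [y] and [y + p] being opposite; [D y] is
   the number of elements of [a] in the half-circle [y] minus the number outside. *)
Let N y := cnt a (y.+1 %/ 2) ((y + p).+1 %/ 2).
Let D y := 2 * INR (N y) - INR k.
Let A x := INR (a x).
(** Half the drop of [D] from [y] to [y.+1]: an even step moves the start of the half-circle past a
    point, an odd step moves its end. *)
Let F y := if odd y then - A ((y + p) %/ 2) else A (y %/ 2).

Lemma half_count_le y : (N y <= n)%N.
Proof. by apply: leq_trans (half (y.+1 %/ 2)); apply: sub_cnt => //; lia. Qed.

Lemma imbalance_le y : D y <= INR L.
Proof.
rewrite /D /L minus_INR ?mult_INR /=; last by lia.
by have := le_INR _ _ (leP (half_count_le y)); lra.
Qed.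

Lemma half_count_anti y : (N (y + p) + N y = k)%N.
Proof.
rewrite /k -(cnt_period (y.+1 %/ 2) pa) addnC /N.
rewrite [RHS](@cnt_cat _ _ ((y + p).+1 %/ 2)); try lia.
by rewrite (_ : (y + p + p).+1 %/ 2 = y.+1 %/ 2 + p)%N //; lia.
Qed.

Lemma imbalance_anti y : D (y + p) = - D y.
Proof. by rewrite /D -(half_count_anti y) plus_INR; ring. Qed.

Lemma imbalance_diff y : D y - D y.+1 = 2 * F y.
Proof.
rewrite /D /F /A /N; case: ifP => yo.
  rewrite (_ : y.+2 %/ 2 = y.+1 %/ 2)%N; last by lia.
  rewrite (_ : (y + p).+1 %/ 2 = (y + p) %/ 2)%N; last by lia.
  rewrite addSn (_ : (y + p).+2 %/ 2 = ((y + p) %/ 2).+1)%N; last by lia.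
  rewrite (@cnt_cat _ _ ((y + p) %/ 2) ((y + p) %/ 2).+1) //; last by lia.
  by rewrite cnt1 plus_INR; ring.
rewrite (_ : y.+2 %/ 2 = (y %/ 2).+1)%N; last by lia.
rewrite (_ : y.+1 %/ 2 = y %/ 2)%N; last by lia.
rewrite addSn (_ : (y + p).+2 %/ 2 = (y + p).+1 %/ 2)%N; last by lia.
rewrite (@cnt_cat _ (y %/ 2) (y %/ 2).+1) //; last by lia.
by rewrite cnt1 plus_INR; ring.
Qed.

Lemma half_count_step y : (N y.+2 <= (N y).+1)%N.
Proof.
rewrite /N (_ : y.+3 %/ 2 = (y.+1 %/ 2).+1)%N; last by lia.
rewrite (_ : (y.+2 + p).+1 %/ 2 = ((y + p).+1 %/ 2).+1)%N; last by lia.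
apply: leq_trans (@sub_cnt a _ _ (y.+1 %/ 2) _ (leqnSn _) (leqnn _)) _.
rewrite (@cnt_cat _ _ ((y + p).+1 %/ 2) ((y + p).+1 %/ 2).+1) //; last by lia.
by rewrite cnt1 -[leqRHS]addn1 leq_add2l leq_b1.
Qed.

Lemma imbalance_step y i : D (y + 2 * i) <= D y + 2 * INR i.
Proof.
elim: i => [|i IH]; first by rewrite muln0 addn0 /=; lra.
apply: Rle_trans (_ : D (y + 2 * i) + 2 <= _); last by rewrite S_INR; lra.
rewrite mulnS addnCA add2n /D.
by have := le_INR _ _ (leP (half_count_step (y + 2 * i))); rewrite S_INR; lra.
Qed.

(** [D (y + (p - i))] is [- D (y - i)], and [D] grows by at most [2] every two steps, which bounds
    the sum by [2 i]; by symmetry it is at most [2 (p - i)], and [imbalance_le] gives [2 L]. *)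
Lemma imbalance_pair y i : (p <= y)%N -> (i <= p)%N ->
  D (y + i) + D (y + (p - i)) <= 2 * INR (trapezoid p L i).
Proof.
move=> py ip.
have key j : (j <= p)%N -> D (y + j) + D (y + (p - j)) <= 2 * INR j.
  move=> jp; have := imbalance_step (y - j) j; have := imbalance_anti (y - j).
  rewrite (_ : y - j + p = y + (p - j))%N; last by lia.
  by rewrite (_ : y - j + 2 * j = y + j)%N; [lra | lia].
have h1 := key i ip.
have := key (p - i)%N (leq_subr _ _); rewrite subKn // => h2.
have := imbalance_le (y + i); have := imbalance_le (y + (p - i)) => h3 h4.
rewrite /trapezoid /minn; case: ifP => _; first by lra.
by case: ifP => _; lra.
Qed.

Let t := PI / (2 * P).

Lemma half_angle_range : 0 < t < PI / 2.
Proof.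
have pi0 := PI_RGT_0; have P2 : 1 < P by apply: (lt_INR 1); lia.
split; first by apply: Rdiv_lt_0_compat; lra.
apply: (Rmult_lt_reg_r (2 * P)); first by lra.
rewrite /t (_ : PI / (2 * P) * (2 * P) = PI); first by nra.
by field; lra.
Qed.

Lemma sin_half_angle_gt0 : 0 < sin t.
Proof. by have [h1 h2] := half_angle_range; apply: sin_gt_0; have := PI_RGT_0; lra. Qed.

Lemma cos_half_angle_gt0 : 0 < cos t.
Proof. by have [h1 h2] := half_angle_range; apply: cos_gt_0; lra. Qed.

(** The sine weight is nonnegative and invariant under [i] to [p - i], so the sum can be folded and
    bounded by [imbalance_pair]. *)
Lemma imbalance_sum y : (p <= y)%N ->
  2 * sin t ^ 2 * rsum p (fun i => D (y + i) * sin (PI * INR i / P)) <= sin (PI * INR L / P).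
Proof.
move=> py; have P0 : 0 < P := INR_gt0 (ltnW (ltnW p0)); have st := sin_half_angle_gt0.
rewrite -(@trapezoid_sum p _ L) //; last by lia.
apply: Rmult_le_compat_l; first by nra.
set f := fun i => D (y + i) * sin (PI * INR i / P).
have e : rsum p (fun i => f (p - i)%N) = rsum p f.
  rewrite rsum_rev; have := rsum_recl p f; rewrite rsumS.
  have -> : f p = 0 by rewrite /f -/P /Rdiv Rmult_assoc Rinv_r ?Rmult_1_r ?sin_PI; [ring | lra].
  have -> : f 0%N = 0 by rewrite /f /= Rmult_0_r /Rdiv Rmult_0_l sin_0; ring.
  by lra.
apply: (Rmult_le_reg_l 2); first by lra.
rewrite -[X in _ <= X]rsum_scal (_ : 2 * rsum p f = rsum p f + rsum p (fun i => f (p - i)%N)); last by rewrite e; ring.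
rewrite -rsum_plus; apply: rsum_le => i ip.
have pi0 := PI_RGT_0.
have s0 : 0 <= sin (PI * INR i / P).
  have i0 := pos_INR i; have iP : INR i <= P by apply: le_INR; lia.
  apply: sin_ge_0; first by apply: Rmult_le_pos; [nra | apply: Rlt_le; apply: Rinv_0_lt_compat].
  apply: (Rmult_le_reg_r P) => //.
  by rewrite /Rdiv Rmult_assoc Rinv_l; nra.
rewrite /f (_ : PI * INR (p - i) / P = PI - PI * INR i / P); last first.
  by rewrite minus_INR -/P; [field; lra | lia].
rewrite sin_minus sin_PI cos_PI.
by have := Rmult_le_compat_r _ _ _ s0 (imbalance_pair py (ltnW ip)); rewrite -/P; lra.
Qed.

Let C := cosine p a 1.
Let S := sine p a 1.
Let v y := - (C * cos (PI * (INR y - / 2) / P) + S * sin (PI * (INR y - / 2) / P)).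

(** [v y] is minus the component of [(C, S)] at the angle [PI (y - 1/2) / P]. It is half the sum of
    [F] against [g] over [2 p] points, and Abel summation turns this into a sum of [D] against
    differences of [g]. The half step in the angle makes these differences sines centred at [y], as
    in [imbalance_sum]. *)
Lemma direction_bound y : (p <= y)%N -> 2 * sin t * v y <= sin (PI * INR L / P).
Proof.
move=> py; have P0 : 0 < P := INR_gt0 (ltnW (ltnW p0)); have st := sin_half_angle_gt0.
pose g (z : R) := - cos (PI * (z - INR y + / 2) / P).
have gp z : g (z + P) = - g z.
  rewrite /g (_ : PI * (z + P - INR y + / 2) / P = PI * (z - INR y + / 2) / P + PI).
    by rewrite neg_cos.
  by field; lra.
pose G x := A x * g (2 * INR x).
have Gp x : G (x + p)%N = G x.
  rewrite /G /A pa plus_INR -/P (_ : 2 * (INR x + P) = 2 * INR x + P + P); last by ring.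
  by rewrite !gp; ring.
have vE : v y = rsum p G.
  set th := PI * (INR y - / 2) / P.
  have -> : v y = - cos th * C + - sin th * S by rewrite /v -/th; ring.
  rewrite /C /S /cosine /sine -!rsum_scal -rsum_plus; apply: eq_rsum => x _.
  rewrite /G /g /A -/P.
  rewrite (_ : PI * (2 * INR x - INR y + / 2) / P =
    2 * PI / P * INR 1 * INR x - th); first by rewrite cos_minus; ring.
  by rewrite /th /=; field; lra.
have e1 : rsum (2 * p) (fun z => F z * g (INR z)) = 2 * v y.
  rewrite rsum_double vE rsum_plus.
  rewrite (@eq_rsum _ _ G); last first.
    by move=> x _; rewrite /F oddM mulKn // mult_INR.
  rewrite (@eq_rsum _ (fun i => F (2 * i).+1 * _) (fun x => G (p.+1 %/ 2 + x)%N)).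
    by rewrite rsum_shift //; ring.
  move=> x _; rewrite /F oddS oddM /G /A (_ : ~~ (odd 2 && odd x)) //.
  rewrite (_ : ((2 * x).+1 + p) %/ 2 = p.+1 %/ 2 + x)%N; last by lia.
  have -> : 2 * INR (p.+1 %/ 2 + x) = INR (2 * x).+1 + P.
    by rewrite -plus_INR -[2]/(INR 2) -mult_INR; congr INR; lia.
  by rewrite gp; ring.
have e2 : 2 * rsum (2 * p) (fun z => F z * g (INR z)) =
    rsum (2 * p) (fun z => D z * (g (INR z) - g (INR z - 1))).
  pose H z := D z * g (INR z - 1).
  have HS : rsum (2 * p) (fun z => H (1 + z)%N) = rsum (2 * p) H.
    apply: rsum_shift => z; rewrite /H mul2n -addnn addnA !imbalance_anti !plus_INR -/P.
    rewrite (_ : INR z + P + P - 1 = INR z - 1 + P + P); last by ring.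
    by rewrite !gp; ring.
  rewrite -rsum_scal (@eq_rsum _ _ (fun z => D z * g (INR z) - H (1 + z)%N)).
    by rewrite rsum_minus HS -rsum_minus; apply: eq_rsum => z _; rewrite /H; ring.
  move=> z _; rewrite /H add1n S_INR (_ : INR z + 1 - 1 = INR z); last by ring.
  by have := imbalance_diff z; nra.
pose E z := D z * sin (PI * (INR z - INR y) / P).
have Ep z : E (z + p)%N = E z.
  rewrite /E imbalance_anti plus_INR -/P.
  rewrite (_ : PI * (INR z + P - INR y) / P = PI * (INR z - INR y) / P + PI).
    by rewrite neg_sin; ring.
  by field; lra.
have e3 : rsum (2 * p) (fun z => D z * (g (INR z) - g (INR z - 1))) =
    4 * sin t * rsum p (fun i => D (y + i) * sin (PI * INR i / P)).
  rewrite (@eq_rsum _ _ (fun z => 2 * sin t * E z)); last first.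
    move=> z _; rewrite /E /g.
    rewrite (_ : PI * (INR z - INR y + / 2) / P = PI * (INR z - INR y) / P + t).
      rewrite (_ : PI * (INR z - 1 - INR y + / 2) / P = PI * (INR z - INR y) / P - t).
        by rewrite cos_plus cos_minus; ring.
      by rewrite /t; field; lra.
    by rewrite /t; field; lra.
  rewrite rsum_scal mul2n -addnn rsum_add (@eq_rsum _ (fun i => E (p + i)%N) E); last first.
    by move=> i _; rewrite addnC Ep.
  rewrite -(rsum_shift y Ep) (@eq_rsum _ _ (fun i => D (y + i) * sin (PI * INR i / P))).
    by ring.
  by move=> i _; rewrite /E plus_INR (_ : INR y + INR i - INR y = INR i); last by ring.
have := imbalance_sum py.
have -> : v y = sin t * rsum p (fun i => D (y + i) * sin (PI * INR i / P)) by lra.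
by rewrite /=; lra.
Qed.

(* The extremal direction among the [2 p] directions of [v] lies within
   [pi / 2p] of the argument of [C + i S]. *)
Lemma lev_bound : C ^ 2 + S ^ 2 <= (sin (PI * INR L / P) / sin (PI / P)) ^ 2.
Proof.
have P0 : 0 < P := INR_gt0 (ltnW (ltnW p0)); have st := sin_half_angle_gt0; have ct := cos_half_angle_gt0.
have vp y : v (y + 2 * p) = v y.
  rewrite /v plus_INR mult_INR -/P.
  rewrite (_ : PI * (INR y + INR 2 * P - / 2) / P = PI * (INR y - / 2) / P + 2 * INR 1 * PI).
    by rewrite cos_period sin_period.
  by rewrite /=; field; lra.
have [|i ip imax] := @exists_max (2 * p) v; first by lia.
have {}imax j : v j <= v i.
  rewrite (divn_eq j (2 * p)); elim: (j %/ _)%N => [|c IH].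
    by rewrite mul0n add0n; apply: imax; rewrite ltn_pmod //; lia.
  by rewrite mulSn -addnA addnC vp.
(* A full turn is added to ensure [p <= y] and that [y.-1] does not truncate. *)
pose y := (i + 2 * p)%N.
have vy : v y = v i by apply: vp.
have up : v y.+1 <= v y by rewrite vy.
have down : v y.-1 <= v y by rewrite vy.
have bound := @direction_bound y (_ : (p <= y)%N); rewrite /y in bound.
have {}bound : 2 * sin t * v y <= sin (PI * INR L / P) by apply: bound; lia.
set th := PI * (INR y - / 2) / P.
have sin2t : sin (PI / P) = 2 * sin t * cos t.
  by rewrite -sin_2a; congr sin; rewrite /t; field; lra.
have cos2t : cos (PI / P) = 1 - 2 * sin t * sin t.
  by rewrite -cos_2a_sin; congr cos; rewrite /t; field; lra.
pose al := v y; pose be := C * sin th - S * cos th.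
have vE : al = - (C * cos th + S * sin th) by [].
have upE : v y.+1 = al * cos (PI / P) + be * sin (PI / P).
  rewrite /v S_INR (_ : PI * (INR y + 1 - / 2) / P = th + PI / P).
    by rewrite cos_plus sin_plus vE /be; ring.
  by rewrite /th; field; lra.
have downE : v y.-1 = al * cos (PI / P) - be * sin (PI / P).
  rewrite /v -subn1 minus_INR; last by rewrite /y; lia.
  rewrite (_ : PI * (INR y - INR 1 - / 2) / P = th - PI / P).
    by rewrite cos_minus sin_minus vE /be; ring.
  by rewrite /th /=; field; lra.
rewrite upE -/al cos2t sin2t in up; rewrite downE -/al cos2t sin2t in down.
have h1 : be * cos t <= al * sin t by nra.
have h2 : - (be * cos t) <= al * sin t by nra.
have norm : C ^ 2 + S ^ 2 = al ^ 2 + be ^ 2.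
  have := sin2_cos2 th; rewrite /Rsqr vE /be => e.
  rewrite (_ : (- (C * cos th + S * sin th)) ^ 2 + (C * sin th - S * cos th) ^ 2 =
    (C ^ 2 + S ^ 2) * (sin th * sin th + cos th * cos th)); first by rewrite e; ring.
  by ring.
have al0 : 0 <= al by nra.
have h3 : (al ^ 2 + be ^ 2) * cos t ^ 2 <= al ^ 2.
  have := sin2_cos2 t; rewrite /Rsqr => e.
  have : (be * cos t) ^ 2 <= (al * sin t) ^ 2 by nra.
  have -> : al ^ 2 = al ^ 2 * (sin t * sin t + cos t * cos t) by rewrite e; ring.
  by nra.
have s2 : 0 < 2 * sin t by lra.
rewrite norm sin2t.
apply: (Rmult_le_reg_r ((2 * sin t * cos t) ^ 2)); first by apply: pow_lt; nra.
rewrite (_ : (sin (PI * INR L / P) / (2 * sin t * cos t)) ^ 2 * (2 * sin t * cos t) ^ 2 =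
  sin (PI * INR L / P) ^ 2); last by field; lra.
rewrite -/al in bound.
have b0 : 0 <= 2 * sin t * al by nra.
have : (2 * sin t * al) ^ 2 <= sin (PI * INR L / P) ^ 2 by apply: pow_incr.
apply: Rle_trans.
rewrite (_ : (al ^ 2 + be ^ 2) * (2 * sin t * cos t) ^ 2 =
  (2 * sin t) ^ 2 * ((al ^ 2 + be ^ 2) * cos t ^ 2)); last by ring.
rewrite (_ : (2 * sin t * al) ^ 2 = (2 * sin t) ^ 2 * al ^ 2); last by ring.
by apply: Rmult_le_compat_l => //; apply: pow2_ge_0.
Qed.

End Lev.

(** * Density bounds *)

Lemma sin_le_tangent x y : 0 <= x -> x < y -> y <= PI -> sin y <= sin x + (y - x) * cos x.
Proof.
move=> x0 xy yp.
have [z [e zr]] := MVT_cor2 sin cos x y xy (fun c _ => derivable_pt_lim_sin c).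
have : cos z <= cos x by apply: cos_decr_1; lra.
by nra.
Qed.

(** That is, [sin x / x] decreases: the sine stays below its tangent at [x], and
    [x * cos x <= sin x]. *)
Lemma sin_chord x y : 0 < x -> x <= y -> y <= PI -> x * sin y <= y * sin x.
Proof.
move=> x0 [xy|->] yp; last by lra.
have h := sin_le_tangent (Rlt_le _ _ x0) xy yp.
have [z [e zr]] := MVT_cor2 sin cos 0 x x0 (fun c _ => derivable_pt_lim_sin c).
have : cos x <= cos z by apply: cos_decr_1; lra.
rewrite sin_0 in e => cxz.
have hx : x * cos x <= sin x by nra.
have h1 := Rmult_le_compat_l x _ _ (Rlt_le _ _ x0) h.
have h2 := Rmult_le_compat_l (y - x) _ _ ltac:(lra) hx.
by lra.
Qed.

Lemma sin_ge_cubic x : 0 <= x -> x <= 4 -> x - x ^ 3 / 6 <= sin x.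
Proof.
move=> x0 x4; have [h _] := pre_sin_bound x 0 x0 x4.
by move: h; rewrite /sin_approx /sin_term /= /Rdiv; lra.
Qed.

Lemma sin_le_quintic x : 0 <= x -> x <= 4 -> sin x <= x - x ^ 3 / 6 + x ^ 5 / 120.
Proof.
move=> x0 x4; have [_ h] := pre_sin_bound x 0 x0 x4.
by move: h; rewrite /sin_approx /sin_term /= /Rdiv; lra.
Qed.

Lemma PI_lower : 3.132 < PI.
Proof.
apply: Rnot_le_lt => h.
(* A Taylor lower bound shows that the cosine is still positive at [1.566], half of [3.132]. *)
have [c _] := @pre_cos_bound 1.566 1 ltac:(lra) ltac:(lra).
have : cos 1.566 <= 0 by apply: cos_le_0; have := PI_RGT_0; have := PI2_3_2; lra.
by move: c; rewrite /cos_approx /cos_term /=; lra.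
Qed.

(** Every half-circle of every dilate has at most [n] elements, so Lev's bound holds at all nonzero
    frequencies and gives the [M] of [fourier_bound]. *)
Lemma density_bound p m a : prime p -> (2 < p)%N -> (2 <= m)%N -> (m + 2 <= p)%N ->
    periodic p a -> sum_free p m a -> (3 * p + 6 <= 10 * cnt a 0 p)%N ->
  INR (cnt a 0 p) ^ 2 * sin (PI / INR p) <= (INR p - INR (cnt a 0 p)) *
    sin (PI * ((2 * INR p - 5 * INR (cnt a 0 p) + 6) / 3) / INR p).
Proof.
move=> p_pr p2 m2 mp pa sf; set k := cnt a 0 p => k1.
have mpos : (0 < m < p)%N by lia.
have k3 : (3 * k <= p + 1)%N := sum_free_card p_pr mpos pa sf.
have podd : odd p.
  by apply: contraTT p_pr => pe; apply/negP=> pp; have := even_prime pp; rewrite (negbTE pe); lia.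
(* The bound of [sum_free_half_window] solved for the count; it makes [2 n - k] at most
   [(2 p - 5 k + 6) / 3]. *)
pose n := ((p + 3 - k) %/ 3)%N.
have half d i : coprime d p -> (cnt (fun x => a (d * x)%N) i (i + p.+1 %/ 2) <= n)%N.
  by move=> dp; have := sum_free_half_window i p_pr m2 mp pa sf k1 dp; rewrite -/k /n; lia.
have kn : (k <= 2 * n)%N.
  have h1 i : (cnt a i (i + p.+1 %/ 2) <= n)%N.
    have := half 1%N i (coprime1n p); rewrite (@eq_cnt _ a) // => x _.
    by rewrite mul1n.
  have := h1 0%N; have := h1 (p.+1 %/ 2)%N; rewrite /k add0n.
  rewrite (@cnt_cat a 0 (p.+1 %/ 2) p) //; last by lia.
  have := @sub_cnt a (p.+1 %/ 2) p (p.+1 %/ 2) (p.+1 %/ 2 + p.+1 %/ 2) (leqnn _) _.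
  by move=> /(_ _); lia.
have Lp : (2 * (2 * n - k) <= p)%N by rewrite /n; lia.
set L := (2 * n - k)%N in Lp.
have P0 : 0 < INR p by apply: lt_0_INR; lia.
have P3 : 3 <= INR p by have := le_INR 3 p (leP p2); rewrite /=; lra.
have pi0 := PI_RGT_0.
have arg_le z : 0 <= z -> 2 * z <= INR p -> 0 <= PI * z / INR p <= PI / 2.
  move=> z0 zp; split.
    by apply: Rmult_le_pos; [nra | apply: Rlt_le; apply: Rinv_0_lt_compat].
  apply: (Rmult_le_reg_r (INR p)) => //.
  by rewrite /Rdiv Rmult_assoc Rinv_l; nra.
have L0 := pos_INR L.
have L2 : 2 * INR L <= INR p by rewrite -[2]/(INR 2) -mult_INR; apply: le_INR; apply/leP.
have s0 : 0 < sin (PI / INR p).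
  apply: sin_gt_0; first by apply: Rdiv_lt_0_compat.
  by apply: (Rmult_lt_reg_r (INR p)) => //; rewrite /Rdiv Rmult_assoc Rinv_l; nra.
have sL0 : 0 <= sin (PI * INR L / INR p).
  by have [h1 h2] := arg_le _ L0 L2; apply: sin_ge_0; lra.
set M := sin (PI * INR L / INR p) / sin (PI / INR p).
have M0 : 0 <= M by apply: Rmult_le_pos => //; apply: Rlt_le; apply: Rinv_0_lt_compat.
have hM r : ~~ (p %| r)%N -> cosine p a r ^ 2 + sine p a r ^ 2 <= M ^ 2.
  move=> pr; have r0 : (0 < r %% p < p)%N by rewrite lt0n pr ltn_pmod //; lia.
  have [d [ed cd]] := inverse_mod p_pr r0.
  have := @lev_bound p (fun x => a (d * x)%N) n p2 podd (periodic_dilate d pa).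
  rewrite cnt_dilate // -/k => /(_ (fun i => half d i cd) kn Lp); rewrite -/L -/M.
  have rd x : exists c, (r * (d * x) = x + c * p)%N \/ (r * (d * x) + c * p = x)%N.
    have : (r * (d * x) = x %[mod p])%N.
      by rewrite mulnA [(r * d)%N]mulnC -modnMml -[(d * r) %% p]modnMmr ed modnMml mul1n.
    move=> e; have [le|lt] := leqP x (r * (d * x)).
      exists ((r * (d * x) - x) %/ p)%N; left.
      rewrite divnK ?subnKC // -eqn_mod_dvd //; exact/eqP.
    exists ((x - r * (d * x)) %/ p)%N; right.
    rewrite divnK ?subnKC ?(ltnW lt) // -eqn_mod_dvd ?(ltnW lt) //; exact/eqP.
  (* Substituting [d * x] for [x], with [d] inverse to [r], turns frequency [r] of [a] into
     frequency [1] of its dilate, the case of [lev_bound]. *)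
  have cE (f : R -> R) : (forall z (c : nat), f (z + 2 * INR c * PI) = f z) ->
      rsum p (fun x => INR (a x) * f (2 * PI / INR p * INR r * INR x)) =
      rsum p (fun x => INR (a (d * x)%N) * f (2 * PI / INR p * INR 1 * INR x)).
    move=> fp.
    rewrite -(rsum_dilate p_pr cd); last first.
      move=> x; rewrite pa plus_INR; congr (_ * _).
      rewrite (_ : _ * (INR x + INR p) = 2 * PI / INR p * INR r * INR x + 2 * INR r * PI) ?fp //.
      by field; lra.
    apply: eq_rsum => x _; congr (_ * _).
    have -> : 2 * PI / INR p * INR r * INR (d * x) = 2 * PI / INR p * INR (r * (d * x)).
      by rewrite (mult_INR r); ring.
    rewrite /= Rmult_1_r; have [c [e|e]] := rd x.
      rewrite e -(fp (2 * PI / INR p * INR x) c); congr f.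
      by rewrite plus_INR mult_INR; field; lra.
    rewrite -[in RHS]e -(fp (2 * PI / INR p * INR (r * (d * x))) c); congr f.
    by rewrite plus_INR (mult_INR c); field; lra.
  by rewrite /cosine /sine !cE //; [exact: sin_period | exact: cos_period].
have := fourier_bound p_pr mpos sf M0 hM; rewrite -/k => hF.
have k0 : 0 < INR k by apply: lt_0_INR; lia.
have kp : INR k <= INR p by apply: le_INR; lia.
have {}hF : INR k ^ 2 <= M * (INR p - INR k).
  by apply: (Rmult_le_reg_r (INR k)) => //; nra.
have {}hF : INR k ^ 2 * sin (PI / INR p) <= (INR p - INR k) * sin (PI * INR L / INR p).
  have -> : sin (PI * INR L / INR p) = M * sin (PI / INR p) by rewrite /M; field; lra.
  by nra.
apply: Rle_trans hF _; apply: Rmult_le_compat_l; first by lra.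
set V := _ / 3.
have kk : 3 * INR p + 6 <= 10 * INR k.
  by have := le_INR _ _ (leP k1); rewrite plus_INR !mult_INR /=; lra.
have V2 : 2 * V <= INR p by rewrite /V; lra.
have LV : INR L <= V.
  have : (3 * L + 5 * k <= 2 * p + 6)%N by rewrite /L /n; lia.
  by move/leP/le_INR; rewrite (plus_INR (3 * L)) (plus_INR (2 * p)) !mult_INR /= /V; lra.
have [h1 h2] := arg_le _ L0 L2; have [h3 h4] := arg_le V ltac:(lra) V2.
apply: sin_incr_1; try lra.
by apply: Rmult_le_compat_r; [apply: Rlt_le; apply: Rinv_0_lt_compat | nra].
Qed.

(* With [q = c p], this is the equation defining [c], relaxed to an
   inequality and cleared of the square root. *)
Definition threshold (P q : R) : Prop :=
  (2 * P - 5 * q + 6) * (P - q + 3) * sin (PI * q / (3 * P)) <= q ^ 3 * sin (PI / P).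

(** Supplies the condition [3 p + 6 <= 10 k] of [density_bound]. For smaller [q] the left side of
    [threshold] is too large; [80 <= P] absorbs the additive constants, giving [q <= 0.31 P]. *)
Lemma threshold_lower P q : 80 <= P -> 0 < q -> threshold P q -> 3 * P + 5 < 10 * q.
Proof.
move=> P80 q0 th; apply: Rnot_le_lt => le.
have pi0 := PI_RGT_0; have pi4 := PI_4.
set x := PI * q / (3 * P).
have ip : 0 < / P by apply: Rinv_0_lt_compat; lra.
have xE : x * (3 * P) = PI * q by rewrite /x; field; lra.
have x0 : 0 < x by nra.
have x1 : x <= 0.41 by nra.
have sx := sin_ge_cubic (Rlt_le _ _ x0) ltac:(lra).
have sp : sin (PI / P) < PI / P by apply: sin_lt_x; apply: Rdiv_lt_0_compat; lra.
have h : (2 * P - 5 * q + 6) * (P - q + 3) * (x * (1 - x ^ 2 / 6)) <= q ^ 3 * (PI / P).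
  apply: Rle_trans (_ : q ^ 3 * sin (PI / P) <= _); last first.
    by apply: Rmult_le_compat_l; [apply: pow_le; lra | lra].
  apply: Rle_trans th; apply: Rmult_le_compat_l; first by nra.
  by rewrite -/x; lra.
have e : q ^ 3 * (PI / P) = 3 * q ^ 2 * x by rewrite /x; field; lra.
have {}h : (2 * P - 5 * q + 6) * (P - q + 3) * (1 - x ^ 2 / 6) <= 3 * q ^ 2.
  by apply: (Rmult_le_reg_r x) => //; lra.
have y1 : 0.97 <= 1 - x ^ 2 / 6 by nra.
have a1 : 0.5 * P <= 2 * P - 5 * q + 6 by lra.
have a2 : 0.7 * P <= P - q + 3 by lra.
have a3 : 0.35 * P ^ 2 <= (2 * P - 5 * q + 6) * (P - q + 3) by nra.
have a4 : 0.33 * P ^ 2 <= 3 * q ^ 2 by nra.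
have a5 : q <= 0.31 * P by lra.
by nra.
Qed.

(** After division by [q], the left side decreases in [q], because [sin_chord] makes
    [sin (PI q / (3 P)) / q] decrease, while the right side increases. *)
Lemma threshold_mono P q k : 0 < P -> 0 < q -> q <= k -> k <= P -> 5 * k <= 2 * P + 6 ->
  threshold P q -> threshold P k.
Proof.
move=> P0 q0 qk kP k5 th; have pi0 := PI_RGT_0.
have ip : 0 < / (3 * P) by apply: Rinv_0_lt_compat; lra.
rewrite /threshold.
have := @sin_chord (PI * q / (3 * P)) (PI * k / (3 * P)).
have h1 : 0 < PI * q / (3 * P) by apply: Rmult_lt_0_compat; nra.
have h2 : PI * q / (3 * P) <= PI * k / (3 * P) by apply: Rmult_le_compat_r; nra.
have h3 : PI * k / (3 * P) <= PI.
  apply: (Rmult_le_reg_r (3 * P)); first by lra.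
  by rewrite /Rdiv Rmult_assoc Rinv_l; nra.
move=> /(_ h1 h2 h3).
have s0 : 0 <= sin (PI * q / (3 * P)) by apply: sin_ge_0; lra.
have sp : 0 <= sin (PI / P).
  apply: Rnot_lt_le => lt; move: th; rewrite /threshold.
  have : 0 < q ^ 3 by apply: pow_lt.
  have : 0 <= (2 * P - 5 * q + 6) * (P - q + 3) * sin (PI * q / (3 * P)).
    by apply: Rmult_le_pos => //; nra.
  by nra.
move: th; rewrite /threshold.
set sq := sin (PI * q / (3 * P)) in s0 *; set sk := sin (PI * k / (3 * P)).
set s := sin (PI / P) in sp *.
move=> th ch.
have {}ch : q * sk <= k * sq.
  apply: (Rmult_le_reg_l (PI * / (3 * P))); first by nra.
  by move: ch; rewrite /Rdiv; lra.
apply: (Rmult_le_reg_l q) => //.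
have c1 : 0 <= (2 * P - 5 * k + 6) * (P - k + 3) by nra.
have c2 : (2 * P - 5 * k + 6) * (P - k + 3) <= (2 * P - 5 * q + 6) * (P - q + 3) by nra.
have d1 := Rmult_le_compat_l _ _ _ c1 ch.
have d2 := Rmult_le_compat_r (k * sq) _ _ ltac:(nra) c2.
have d3 := Rmult_le_compat_l k _ _ ltac:(lra) th.
have d4 : q ^ 2 <= k ^ 2 by nra.
have kqs : 0 <= k * q * s by apply: Rmult_le_pos => //; nra.
have d5 := Rmult_le_compat_r _ _ _ kqs d4.
by lra.
Qed.

(** If [k >= q], the threshold holds at [k]. In [density_bound], [sin_chord] replaces the sine at
    [PI (2P - 5k + 6) / (3P)] by a multiple of the sine at [PI k / (3P)]. The result contradicts the
    threshold, since [P - k < P - k + 3]. *)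
Lemma sum_free_lt_threshold p m a q : prime p -> (80 <= p)%N -> (2 <= m)%N ->
    (m + 2 <= p)%N -> periodic p a -> sum_free p m a ->
    0 < q -> threshold (INR p) q -> INR (cnt a 0 p) < q.
Proof.
move=> p_pr p80 m2 mp pa sf q0 th; apply: Rnot_le_lt; set k := cnt a 0 p => qk.
have mpos : (0 < m < p)%N by lia.
have k3 : (3 * k <= p + 1)%N := sum_free_card p_pr mpos pa sf.
have P80 : 80 <= INR p.
  by have := le_INR _ _ (leP p80); rewrite (_ : INR 80 = 80) // INR_IZR_INZ.
have K3 : 3 * INR k <= INR p + 1.
  by have := le_INR _ _ (leP k3); rewrite (plus_INR p) mult_INR /=; lra.
have thk : threshold (INR p) (INR k) by apply: (@threshold_mono _ q) => //; lra.
have k1 : (3 * p + 6 <= 10 * k)%N.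
  have := threshold_lower P80 q0 th => lt.
  have : INR (3 * p + 5) < INR (10 * k).
    by rewrite (plus_INR (3 * p)) !mult_INR /=; lra.
  by move/INR_lt; lia.
have p2 : (2 < p)%N by lia.
have := density_bound p_pr p2 m2 mp pa sf k1; rewrite -/k.
move: thk; rewrite /threshold; set P := INR p in P80 K3 *; set K := INR k in qk K3 *.
have pi0 := PI_RGT_0.
have ip : 0 < / (3 * P) by apply: Rinv_0_lt_compat; lra.
have V3 : PI * K / (3 * P) <= PI * ((2 * P - 5 * K + 6) / 3) / P.
  rewrite (_ : PI * ((2 * P - 5 * K + 6) / 3) / P = PI * (2 * P - 5 * K + 6) / (3 * P)).
    by apply: Rmult_le_compat_r; nra.
  by field; lra.
have V4 : PI * ((2 * P - 5 * K + 6) / 3) / P <= PI.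
  apply: (Rmult_le_reg_r P); first by lra.
  rewrite (_ : _ / P * P = PI * ((2 * P - 5 * K + 6) / 3)); first by nra.
  by field; lra.
have x0 : 0 < PI * K / (3 * P) by apply: Rmult_lt_0_compat; nra.
have := sin_chord x0 V3 V4.
have s0 : 0 < sin (PI * K / (3 * P)).
  apply: sin_gt_0 => //; apply: (Rmult_lt_reg_r (3 * P)); first by lra.
  by rewrite /Rdiv Rmult_assoc Rinv_l; nra.
set W := sin (PI * (_ / 3) / P); set V := sin (PI * K / (3 * P)) in s0 *.
set S := sin (PI / P) => ch thK de.
have {}ch : K * W <= (2 * P - 5 * K + 6) * V.
  apply: (Rmult_le_reg_l (PI / (3 * P))); first by apply: Rdiv_lt_0_compat; lra.
  apply: Rle_trans (_ : PI * K / (3 * P) * W <= _); first by apply: Req_le; field; lra.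
  by apply: Rle_trans ch _; apply: Req_le; field; lra.
have K0 : 0 < K by lra.
have h1 := Rmult_le_compat_l K _ _ (Rlt_le _ _ K0) de.
have h2 := Rmult_le_compat_l (P - K) _ _ ltac:(lra) ch.
have h3 : 0 < (2 * P - 5 * K + 6) * V by apply: Rmult_lt_0_compat; lra.
by nra.
Qed.

(** * Return to finite sets, and the numerical bounds *)

Lemma sum_free_set p m (A : {set 'I_p}) : prime p -> m_sum_free p m A ->
  exists a, [/\ periodic p a, sum_free p m a & cnt a 0 p = #|A|].
Proof.
move=> p_pr /forall_inP sf.
exists (fun x => [exists y in A, nat_of_ord y == x %% p]%N); split.
- by move=> x; rewrite modnDr.
- move=> x y z /exists_inP[x' xA /eqP ex] /exists_inP[y' yA /eqP ey] /exists_inP[z' zA /eqP ez].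
  have := sf _ xA => /forall_inP /(_ _ yA) /forall_inP /(_ _ zA).
  by rewrite ex ey ez modnDm modnMmr.
rewrite /cnt big_mkord -sum1_card [RHS]big_mkcond /=; apply: eq_bigr => i _.
rewrite modn_small //; case: (boolP (i \in A)) => iA.
  by rewrite (_ : [exists _ in _, _]) //; apply/exists_inP; exists i.
rewrite (_ : [exists _ in _, _] = false) //; apply/negbTE/negP=> /exists_inP[y yA /eqP/val_inj e].
by rewrite -e yA in iA.
Qed.

Lemma dmZp_lt p m c : prime p -> (80 <= p)%N -> (2 <= m)%N -> (m <= p - 2)%N ->
  0 < c -> threshold (INR p) (c * INR p) -> dmZp p m < c.
Proof.
move=> p_pr p80 m2 mp c0 th; have P0 : 0 < INR p by apply: lt_0_INR; lia.
rewrite /dmZp; apply: (Rmult_lt_reg_r (INR p)) => //.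
rewrite /Rdiv Rmult_assoc Rinv_l ?Rmult_1_r; last by lra.
have sf0 : m_sum_free p m set0 by apply/forall_inP=> x; rewrite inE.
have [A sfA ->] : {A | m_sum_free p m A & \max_(A : {set 'I_p} | m_sum_free p m A) #|A| = #|A|}.
  by apply: eq_bigmax_cond; apply/card_gt0P; exists set0.
have [a [pa sf <-]] := sum_free_set p_pr sfA.
by apply: (sum_free_lt_threshold p_pr p80 m2 _ pa sf _ th); [lia | nra].
Qed.

(** With [q = c P] the equation reads [Y q = 4 P + 12 - 7 q] for the root [Y]; squaring and
    subtracting [9 q^2] leaves a difference of squares that factors as
    [8 (2P - 5q + 6) (P - q + 3)]. *)
Lemma threshold_of_equation P c : 1 < P -> 0 < c < 1 ->
  (7 + sqrt (8 * c * P * sin (PI / P) / sin (PI * c / 3) + 9)) * c = 4 + 12 / P ->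
  threshold P (c * P).
Proof.
move=> P1 c01 eq; have P0 : 0 < P by lra.
have pi0 := PI_RGT_0.
have s0 : 0 < sin (PI / P).
  apply: sin_gt_0; first by apply: Rdiv_lt_0_compat.
  by apply: (Rmult_lt_reg_r P) => //; rewrite /Rdiv Rmult_assoc Rinv_l; nra.
have v0 : 0 < sin (PI * c / 3) by apply: sin_gt_0; nra.
rewrite /threshold (_ : PI * (c * P) / (3 * P) = PI * c / 3); last by field; lra.
move: eq s0 v0; set s := sin (PI / P); set v := sin (PI * c / 3) => eq s0 v0.
set X := 8 * c * P * s / v in eq.
have X0 : 0 <= X + 9.
  have : 0 < X by apply: Rdiv_lt_0_compat => //; apply: Rmult_lt_0_compat => //; nra.
  by lra.
have Y2 := sqrt_sqrt _ X0; set Y := sqrt (X + 9) in eq Y2.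
have Yc : Y * (c * P) = 4 * P + 12 - 7 * (c * P).
  have : (7 + Y) * c * P = (4 + 12 / P) * P by rewrite eq.
  rewrite (_ : (4 + 12 / P) * P = 4 * P + 12); last by field; lra.
  by lra.
have Xv : X * v = 8 * (c * P) * s by rewrite /X; field; lra.
set q := c * P in Yc Xv *.
have e1 : (Y * q) * (Y * q) = X * q ^ 2 + 9 * q ^ 2.
  have -> : (Y * q) * (Y * q) = (Y * Y) * q ^ 2 by ring.
  by rewrite Y2; ring.
have e2 : X * q ^ 2 = 8 * ((2 * P - 5 * q + 6) * (P - q + 3)).
  by rewrite Yc in e1; lra.
have : X * v * q ^ 2 = X * q ^ 2 * v by ring.
by rewrite Xv e2; lra.
Qed.

(** For large [P] the claim tends to [(2 - 5c) (1 - c) sin x / x <= 3 c^2] with [x = PI c / 3]. The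
    decimal bounds used here leave a margin of order [10^-5], far above the errors of order
    [1 / P]. *)
Lemma threshold_limit P : 100000000 <= P -> threshold P (10000 / 31955 * P).
Proof.
move=> PB; have pi0 := PI_RGT_0; have pi4 := PI_4; have pil := PI_lower.
set c := 10000 / 31955.
rewrite /threshold (_ : PI * (c * P) / (3 * P) = PI * c / 3); last by field; lra.
have c1 : 0.3129400719 < c < 0.312940073 by rewrite /c; lra.
have cP : 0.3129400719 * P <= c * P <= 0.312940073 * P by nra.
set x := PI * c / 3.
have x1 : 0.3267 <= x by rewrite /x; nra.
have x2 : x <= 0.42 by rewrite /x; nra.
have sx := @sin_le_quintic x ltac:(lra) ltac:(lra).
have kx : sin x <= 0.982307 * x.
  have t1 : 0.1067 <= x ^ 2 by nra.
  have t2 : x ^ 2 <= 0.18 by nra.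
  have : 1 - x ^ 2 / 6 + (x ^ 2) ^ 2 / 120 <= 0.982307 by nra.
  by move=> h; have := Rmult_le_compat_l x _ _ ltac:(lra) h; lra.
have u0 : 0 < PI / P by apply: Rdiv_lt_0_compat; lra.
have uE : PI / P * P = PI by field; lra.
have u4 : PI / P <= 4 by nra.
have su := sin_ge_cubic (Rlt_le _ _ u0) u4.
have su' : PI * (P ^ 2 - 3) <= P ^ 3 * sin (PI / P).
  have h := Rmult_le_compat_l (P ^ 3) _ _ ltac:(apply: pow_le; lra) su.
  apply: Rle_trans h.
  rewrite (_ : P ^ 3 * (PI / P - (PI / P) ^ 3 / 6) = PI * (P ^ 2 - PI ^ 2 / 6)); last by field; lra.
  by apply: Rmult_le_compat_l; [lra | have : PI ^ 2 <= 16 by nra]; lra.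
apply: Rle_trans (_ : (c ^ 3) * (PI * (P ^ 2 - 3)) <= _); last first.
  rewrite Rpow_mult_distr Rmult_assoc; apply: Rmult_le_compat_l => //.
  by apply: pow_le; lra.
apply: Rle_trans (_ : (2 * P - 5 * (c * P) + 6) * (P - c * P + 3) * (0.982307 * x) <= _).
  by apply: Rmult_le_compat_l => //; apply: Rmult_le_pos; lra.
rewrite (_ : c ^ 3 * (PI * (P ^ 2 - 3)) = 3 * c ^ 2 * (P ^ 2 - 3) * x); last by rewrite /x; field.
rewrite -Rmult_assoc; apply: Rmult_le_compat_r; first by lra.
have b1 : 0 <= 2 * P - 5 * (c * P) + 6 <= 0.43529965 * P + 6 by lra.
have b2 : 0 <= P - c * P + 3 <= 0.68705993 * P + 3 by lra.
have c2 : 0.2937944 <= 3 * c ^ 2 by nra.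
have b3 := Rmult_le_compat_r (P ^ 2 - 3) _ _ ltac:(nra) c2.
have b4 := Rmult_le_compat _ _ _ _ (proj1 b1) (proj1 b2) (proj2 b1) (proj2 b2).
have b5 : 100000000 * P <= P ^ 2 by nra.
by lra.
Qed.

Theorem theorem1p5 :
  (forall (p m : nat) (c : R),
      prime p -> (80 <= p)%N -> (2 <= m)%N -> (m <= p - 2)%N ->
      0 < c < 1 ->
      (7 + sqrt (8 * c * INR p * sin (PI / INR p) / sin (PI * c / 3) + 9)) * c
        = 4 + 12 / INR p ->
      dmZp p m < c)
  /\
  (forall (m : nat) (l : R), (3 <= m)%N -> dm_limit m l -> l <= 10000 / 31955).
Proof.
split=> [p m c p_pr p80 m2 mp c01 eq|m l m3 lim].
  have P1 : 1 < INR p by apply: (lt_INR 1); lia.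
  by apply: dmZp_lt => //; [lra | apply: threshold_of_equation].
apply: Rnot_lt_le => lt.
(* The tolerance is the whole excess of [l] over the bound, so a single large prime contradicts
   convergence. *)
have [N hN] := lim (l - 10000 / 31955) ltac:(lra).
have [B hB] := INR_unbounded 100000000.
have [p pN p_pr] := prime_above (N + B + m + 80).
have pB : 100000000 <= INR p by apply: Rlt_le; apply: Rlt_le_trans hB _; apply: le_INR; lia.
have := hN p p_pr ltac:(lia).
have : dmZp p m < 10000 / 31955.
  by apply: dmZp_lt (threshold_limit pB) => //; [lia | lia | lia | lra].
by move=> h1 /Rabs_def2[h2 h3]; lra.
Qed.
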